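(* Let $(Z_n)_{n\ge 0}$ be a supercritical branching process with immigration in an i.i.d. random environment (as described in the context), with $0<m_1<\infty$ a.s., $\mathbb{E}\log m_1\in(0,\infty)$ and $\mathbb{P}(h(\{0\})<1)>0$. Assume that (A) $\mathbb{P}\big(h(\{0\})>0,\ f(\{0\})>0,\ f(\{1\})>0\big)>0$, and (B) there exists $\delta\in(0,1)$ such that $f(\{0\})<\delta$ a.s. Then there exists $\varrho\in(-\infty,0)$ such that for all integers $k,j\ge 1$, $$\lim_{n\to\infty}\frac1n\log \mathbb{P}_k(Z_n=j)=\varrho .$$ Moreover, for every sequence $\{k_n\}$ such that $k_n\ge 1$ for $n$ large enough and $k_n/n\to 0$ as $n\to\infty$, $$\lim_{n\to\infty}\frac1n\log\mathbb{P}_1(1\le Z_n\le k_n)=\varrho .$$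
   Context: $\mathbb{N}=\{0,1,2,\dots\}$. Let $\Delta$ be the space of pairs of probability measures on $\mathbb{N}$, with the component-wise total variation metric. Let $\mathbf Q=(f,h)$ be a random element of $\Delta$ and let $\mathbf Q_n=(f_n,h_n)$, $n\ge1$, be independent copies of $\mathbf Q$ (independence of $f_n$ and $h_n$ for fixed $n$ is not assumed). The sequence $\xi=(\mathbf Q_1,\mathbf Q_2,\dots)$ is the random environment. The branching process with immigration in the random environment $\xi$ is the $\mathbb{N}$-valued process $(Z_n)$ with $Z_0=k\in\mathbb{N}\setminus\{0\}$ which, given $\xi$, is a Markov chain satisfying $Z_n=\sum_{i=1}^{Z_{n-1}}N_{n,i}+Y_n$ for $n\ge1$, where given $\xi$ all the variables $N_{n,i},Y_n$ are independent (and independent of the past), the $N_{n,i}$, $i\ge1$, have law $f_n$ (offspring) and $Y_n$ has law $h_n$ (immigrants). $\mathbb{P}$ is the annealed probability (averaged over $\xi$); $\mathbb{P}_k(\cdot)=\mathbb{P}(\cdot\mid Z_0=k)$. $m_n=\sum_{j\ge0} j f_n(\{j\})$ is the mean of $f_n$. *)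

(* Defs.v *)
From HB Require Import structures.
From mathcomp Require Import all_boot all_order all_algebra finmap.
From mathcomp Require Import all_classical all_reals all_analysis.

Set Implicit Arguments.
Unset Strict Implicit.
Unset Printing Implicit Defensive.

Import Order.TTheory GRing.Theory Num.Theory.
Import numFieldNormedType.Exports.

Local Open Scope classical_set_scope.
Local Open Scope ring_scope.
Local Open Scope ereal_scope.

(* Pairs (f, h): offspring law and immigration law. *)
Definition Delta (R : realType) : Type :=
  (probability nat R * probability nat R)%type.

Definition tv_dist (R : realType) (p q : probability nat R) : R :=
  sup [set `|fine (p A) - fine (q A)|%R | A in [set: set nat]].

Definition Delta_open (R : realType) (U : set (Delta R)) : Prop :=
  forall q, U q -> exists2 e : R, (0 < e)%R & forall q' : Delta R,
    (tv_dist q.1 q'.1 < e)%R -> (tv_dist q.2 q'.2 < e)%R -> U q'.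

Definition Delta_borel (R : realType) : set (set (Delta R)) :=
  <<s @Delta_open R >>.

Definition random_env (R : realType) (d : measure_display)
    (T : measurableType d) (Q : T -> Delta R) : Prop :=
  forall B, Delta_borel B -> measurable (Q @^-1` B).

(* The product rule is required over every finite set of indices. *)
Definition env_independent (R : realType) (d : measure_display)
    (T : measurableType d) (P : probability T R) (Qn : nat -> T -> Delta R)
    : Prop :=
  forall (J : {fset nat}) (B : nat -> set (Delta R)),
    (forall n, Delta_borel (B n)) ->
    P (\bigcap_(n in [set` J]) (Qn n @^-1` B n)) =
    \prod_(n <- J) P (Qn n @^-1` B n).

Definition independent_copies (R : realType) (d : measure_display)
    (T : measurableType d) (P : probability T R) (Q : T -> Delta R)
    (Qn : nat -> T -> Delta R) : Prop :=
  [/\ forall n, random_env (Qn n),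
      forall n B, Delta_borel B -> P (Qn n @^-1` B) = P (Q @^-1` B)
    & env_independent P Qn].

(* The sigma-algebra generated by the whole environment (past and future). *)
Definition sigma_env (R : realType) (d : measure_display)
    (T : measurableType d) (Qn : nat -> T -> Delta R) : set (set T) :=
  <<s [set E | exists n, exists2 B, Delta_borel B & E = Qn n @^-1` B] >>.

(* Conditionally on the environment, all the N n i and Y n are independent,
   N n i having law (Qn n).1 and Y n having law (Qn n).2.  The conditional
   probability of a finite-dimensional rectangle is characterised by its
   integrals over the events of sigma_env Qn; coordinates that one wants to
   leave out of the rectangle are covered by A n i = setT or C n = setT. *)
Definition quenched_independent (R : realType) (d : measure_display)
    (T : measurableType d) (P : probability T R) (Qn : nat -> T -> Delta R)
    (N : nat -> nat -> T -> nat) (Y : nat -> T -> nat) : Prop :=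
  forall (E : set T) (m r : nat) (A : nat -> nat -> set nat)
      (C : nat -> set nat), sigma_env Qn E ->
    P (E `&` \bigcap_(n < m)
               (Y n @^-1` C n `&` \bigcap_(i < r) (N n i @^-1` A n i))) =
    \int[P]_(w in E)
      \prod_(n < m) ((Qn n w).2 (C n) * \prod_(i < r) (Qn n w).1 (A n i)).

(* Time is shifted by one: Qn n, N n i and Y n are the environment, the
   offspring numbers and the immigration that produce generation n + 1 from
   generation n (Q_{n+1}, N_{n+1,i+1} and Y_{n+1} in 1-based numbering).  *)
Record branching_data (R : realType) (d : measure_display)
    (T : measurableType d) (P : probability T R) (Q : T -> Delta R)
    (Qn : nat -> T -> Delta R) (N : nat -> nat -> T -> nat)
    (Y : nat -> T -> nat) : Prop := BranchingData {
  bd_env : random_env Q;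
  bd_copies : independent_copies P Q Qn;
  bd_offspring_meas : forall n i, measurable_fun setT (N n i);
  bd_immigrants_meas : forall n, measurable_fun setT (Y n);
  bd_quenched : quenched_independent P Qn N Y }.

(* Size of generation n when generation 0 has k individuals. *)
Fixpoint bpire (T : Type) (N : nat -> nat -> T -> nat) (Y : nat -> T -> nat)
    (k n : nat) (w : T) {struct n} : nat :=
  match n with
  | 0%N => k
  | n'.+1 => (\sum_(i < bpire N Y k n' w) N n' i w + Y n' w)%N
  end.

Definition law_mean (R : realType) (p : probability nat R) : \bar R :=
  \sum_(0 <= j <oo) j%:R%:E * p [set j].

(* Main.v *)
Require Import Defs.
From HB Require Import structures.
From mathcomp Require Import all_boot all_order all_algebra finmap.
From mathcomp Require Import all_classical all_reals all_analysis.
From mathcomp Require Import measurable_realfun.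
From mathcomp Require Import ring lra.

Import Order.TTheory GRing.Theory Num.Theory.
Import numFieldNormedType.Exports.
Import HBNNSimple.

(** Averaged over the environment, the process is a homogeneous Markov chain
    on the natural numbers: independence of the environments makes the family
    events of different generations independent, and the one-step kernel
    [annealed] is the mean of the quenched kernel [quenched] ([bpire_law]).
    Write [p n k j] for its [n]-step transition probabilities.

    Existence of the rate.  [p n 1 1] is supermultiplicative and positive, so
    Fekete's lemma ([superadditive_cvg]) yields the limit [rho] of
    [ln (p n 1 1) / n].  Assumption (A) allows every population to drop to any
    smaller one in one step ([annealed_down]), supercriticality and
    immigration allow it to grow ([annealed_up_all]), hence the transition
    probabilities between positive states are squeezed between multiples of
    shifted return probabilities of [1] ([transition_rate]).  Dropping from
    [l] to [1] costs at most a factor [e ^ (l + 2)], which is subexponential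
    along [l <= kn n = o(n)]; this gives the second limit
    ([small_population_rate]).

    Negativity of the rate.  It suffices to find a positive function [W] and
    [gamma < 1] with [K W <= gamma W] for the annealed kernel [K]
    ([iter_kernel_decay]).  For large populations [k ^ -alpha] contracts.
    Indeed, by Chernoff's bound the next generation has at least
    [theta * m * k] individuals outside an event of exponentially small
    probability ([quenched_drift]), where [m] is the mean of a truncated
    offspring law, and [E (theta * m) ^ -alpha < 1] for small [alpha] because
    [E (ln (theta * m)) > 0] ([annealed_drift]).  This is where assumption (B)
    enters: it bounds [m] from below, so that negative moments exist and the
    truncation can be removed by dominated convergence
    ([trunc_log_mean_pos]).  On the finitely many small populations the
    function is replaced by a concave one, which contracts since each of these
    populations can grow ([lyapunov_repair]). *)

Local Open Scope classical_set_scope.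
Local Open Scope ring_scope.
Local Open Scope ereal_scope.

(** * Measure-theoretic preliminaries *)

Lemma measurable_preimage (d d' : measure_display) (T : measurableType d)
    (E : measurableType d') (X : T -> E) (B : set E) :
  measurable_fun setT X -> measurable B -> measurable (X @^-1` B).
Proof. by move=> mX mB; rewrite -[X in measurable X]setTI; exact: mX. Qed.

Lemma measurable_superlevel (R : realType) (d : measure_display)
    (T : measurableType d) (g : T -> R) (e : R) :
  measurable_fun setT g -> measurable [set w | (e <= g w)%R].
Proof.
move=> mg; rewrite (_ : [set _ | _] = g @^-1` `[e, +oo[%classic).
  exact: measurable_preimage.
by apply/seteqP; split => w /=; rewrite in_itv/= andbT.
Qed.

Lemma measurable_strict_superlevel (R : realType) (d : measure_display)
    (T : measurableType d) (g : T -> R) (e : R) :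
  measurable_fun setT g -> measurable [set w | (e < g w)%R].
Proof.
move=> mg; rewrite (_ : [set _ | _] = g @^-1` `]e, +oo[%classic).
  exact: measurable_preimage.
by apply/seteqP; split => w /=; rewrite in_itv/= andbT.
Qed.

Lemma fine_prob01 (R : realType) (d : measure_display) (T : measurableType d)
  (p : probability T R) (A : set T) : measurable A -> (0 <= fine (p A) <= 1)%R.
Proof.
move=> mA; rewrite fine_ge0//= -[leRHS]/(fine 1%E).
by rewrite fine_le ?fin_num_measure// probability_le1.
Qed.

Lemma integral01 (R : realType) (d : measure_display) (T : measurableType d)
    (P : probability T R) (f : T -> R) : measurable_fun setT f ->
  (forall x, 0 <= f x <= 1)%R -> 0 <= \int[P]_x (f x)%:E <= 1.
Proof.
move=> mf f01; apply/andP; split.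
  by apply: integral_ge0 => x _; rewrite lee_fin; case/andP: (f01 x).
have <- : \int[P]_x cst 1 x = 1 by rewrite integral_cst// mul1e; exact: probability_setT.
apply: ge0_le_integral => //.
- by move=> x _; rewrite lee_fin; case/andP: (f01 x).
- exact/measurable_EFinP.
- by move=> x _; rewrite lee_fin; case/andP: (f01 x).
Qed.

Lemma integral01_fin_num (R : realType) (d : measure_display)
    (T : measurableType d) (P : probability T R) (f : T -> R) :
  measurable_fun setT f -> (forall x, 0 <= f x <= 1)%R ->
  \int[P]_x (f x)%:E \is a fin_num.
Proof.
move=> mf f01; have /andP[I0 I1] := @integral01 _ _ _ P _ mf f01.
by rewrite ge0_fin_numE// (le_lt_trans I1) ?ltry.
Qed.

Lemma pos_superlevel (R : realType) (d : measure_display)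
    (T : measurableType d) (P : {measure set T -> \bar R}) (g : T -> R) :
  measurable_fun setT g -> 0 < P [set w | (0 < g w)%R] ->
  exists2 e : R, (0 < e)%R & 0 < P [set w | (e <= g w)%R].
Proof.
move=> mg Pg.
have mset (e : R) : measurable [set w | (e <= g w)%R] by exact: measurable_superlevel.
apply: contrapT => none.
have null n : P [set w | (n.+1%:R^-1 <= g w)%R] = 0.
  apply/eqP; rewrite eq_le measure_ge0 andbT leNgt; apply/negP => Pn.
  by apply: none; exists n.+1%:R^-1%R => //; rewrite invr_gt0 ltr0n.
have : P.-negligible [set w | (0 < g w)%R].
  apply: (@negligibleS _ _ _ P (\bigcup_n [set w | (n.+1%:R^-1 <= g w)%R])).
    move=> w /= gw; exists (Num.bound (g w)^-1) => //=.
    rewrite -[leRHS]invrK lef_pV2 ?posrE ?ltr0n ?invr_gt0//.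
    rewrite (le_trans (ltW (archi_boundP _)))// ?ler_nat//.
    by rewrite invr_ge0 ltW.
  by apply: negligible_bigcup => n; apply/negligibleP; [exact: mset|exact: null].
move/negligibleP => P0; move: Pg; rewrite P0 ?ltxx//.
exact: measurable_strict_superlevel.
Qed.

Lemma measure_fibers (R : realType) (d : measure_display)
    (T : measurableType d) (P : {measure set T -> \bar R}) (X : T -> nat)
    (E : set T) : measurable_fun setT X -> measurable E ->
  P E = \sum_(0 <= a <oo) P (E `&` X @^-1` [set a]).
Proof.
move=> mX mE.
have mXa a : measurable (X @^-1` [set a]) by exact: measurable_preimage.
rewrite [in LHS](_ : E = \bigcup_a (E `&` X @^-1` [set a])); last first.
  by apply/seteqP; split => [w Ew|w [a _ []]//]; exists (X w).
rewrite measure_semi_bigcup//.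
- by move=> a; exact: measurableI.
- apply/trivIsetP => a b _ _ /eqP ab; apply/seteqP; split => // w.
  by case=> -[_ /= Xa] [_ /= Xb]; apply: ab; rewrite -Xa -Xb.
- by apply: bigcup_measurable => a _; exact: measurableI.
Qed.

Lemma measure_fibers_ord (R : realType) (d : measure_display)
    (T : measurableType d) (P : {measure set T -> \bar R}) (X : T -> nat)
    (E : set T) (n : nat) : measurable_fun setT X -> measurable E ->
  (forall w, E w -> (X w < n)%N) ->
  P E = \sum_(a < n) P (E `&` X @^-1` [set (a : nat)]).
Proof.
move=> mX mE EX.
have mXa a : measurable (X @^-1` [set a]) by exact: measurable_preimage.
rewrite [in LHS](_ : E = \big[setU/set0]_(a < n) (E `&` X @^-1` [set (a : nat)])).
  rewrite (@measure_bigsetU _ _ _ _ (fun a => E `&` X @^-1` [set a]))//.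
  + by move=> a; exact: measurableI.
  + apply/trivIsetP => a b _ _ /eqP ab; apply/seteqP; split => // w.
    by case=> -[_ /= Xa] [_ /= Xb]; apply: ab; rewrite -Xa -Xb.
rewrite -(bigcup_mkord n (fun a => E `&` X @^-1` [set a])).
by apply/seteqP; split => [w Ew|w [a _ []]//]; exists (X w) => //=; exact: EX.
Qed.

(** A product formula that is known for events extends to non-negative
    functions: to simple functions by linearity, then by monotone
    convergence. *)
Lemma integral_mul_comp (R : realType) (d d' : measure_display)
    (T : measurableType d) (E : measurableType d') (P : {measure set T -> \bar R})
    (nu : {measure set E -> \bar R}) (X : T -> E) (g : T -> R) (c : R)
    (mX : measurable_fun setT X) (mg : measurable_fun setT g)
    (g0 : forall x, (0 <= g x)%R) :
  (forall B, measurable B ->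
    \int[P]_x ((g x)%:E * (\1_B (X x))%:E) = c%:E * nu B) ->
  forall phi : E -> \bar R, (forall x, 0 <= phi x) ->
  measurable_fun setT phi ->
  \int[P]_x ((g x)%:E * phi (X x)) = c%:E * \int[nu]_x phi x.
Proof.
move=> gX phi phi0 mphi.
have mg' : measurable_fun setT (fun x => (g x)%:E) by exact/measurable_EFinP.
pose h := nnsfun_approx measurableT mphi.
have hphi x : (h n x)%:E @[n --> \oo] --> phi x by exact: cvg_nnsfun_approx.
have hnd x : {homo (fun n => (h n x)%:E) : n m / (n <= m)%N >-> n <= m}.
  by move=> n m nm; rewrite lee_fin; exact/lefP/nd_nnsfun_approx.
have mh n : measurable_fun setT (fun x => (h n x)%:E).
  by apply/measurable_EFinP; exact: measurable_funPT.
have hn n : \int[P]_x ((g x)%:E * (h n (X x))%:E) = c%:E * \int[nu]_x (h n x)%:E.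
  have mi (y : R) : measurable (h n @^-1` [set y]) by exact: measurable_sfunP.
  under eq_integral => x _.
    rewrite fimfunE -fsumEFin// ge0_mule_fsumr; last first.
      by move=> y; rewrite EFinM nnfun_muleindic_ge0.
    over.
  rewrite ge0_integral_fsum//; last 2 first.
  - move=> y; apply: emeasurable_funM => //; apply/measurable_EFinP.
    apply: measurable_funM => //.
    by apply: measurableT_comp => //.
  - by move=> y x _; rewrite mule_ge0// ?lee_fin// -lee_fin EFinM nnfun_muleindic_ge0.
  rewrite integralT_nnsfun sintegralE ge0_mule_fsumr; last first.
    by move=> y; exact: nnsfun_mulemu_ge0.
  apply: eq_fsbigr => y /[!inE] -[z _ hz].
  have y0 : (0 <= y)%R by rewrite -hz.
  under eq_integral do rewrite EFinM muleCA.
  rewrite ge0_integralZl//.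
  - by rewrite gX// muleCA.
  - apply: emeasurable_funM => //; apply/measurable_EFinP.
    by apply: measurableT_comp => //.
  - by move=> x _; rewrite mule_ge0// lee_fin.
have cvg2 : c%:E * \int[nu]_x (h n x)%:E @[n --> \oo] --> c%:E * \int[nu]_x phi x.
  apply: cvgeZl => //.
  rewrite (_ : \int[nu]_x phi x = \int[nu]_x limn (fun n => (h n x)%:E)); last first.
    by apply: eq_integral => x _; apply/esym/cvg_lim => //.
  apply: cvg_monotone_convergence => //.
  by move=> n x _; rewrite lee_fin.
apply/esym; apply: (cvg_unique _ cvg2) => //.
rewrite (_ : (fun n => _) = fun n => \int[P]_x ((g x)%:E * (h n (X x))%:E)); last first.
  by apply/funext => n; rewrite hn.
rewrite (_ : \int[P]_x _ = \int[P]_x limn (fun n => (g x)%:E * (h n (X x))%:E)).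
  apply: cvg_monotone_convergence => //.
  - move=> n; apply: emeasurable_funM => //.
    apply/measurable_EFinP; apply: measurableT_comp => //.
  - by move=> n x _; rewrite mule_ge0// lee_fin.
  - by move=> x _ n m nm; apply: lee_pmul => //; rewrite ?lee_fin//; have := hnd (X x) _ _ nm.
apply: eq_integral => x _; apply/esym/cvg_lim => //.
by apply: cvgeZl.
Qed.

(** * Environments *)

Lemma tv_dist_ge (R : realType) (p q : probability nat R) (A : set nat) :
  (`|fine (p A) - fine (q A)| <= tv_dist p q)%R.
Proof.
apply: ub_le_sup; last by exists A.
exists 1%R => _ [B _ <-].
have pr01 (r : probability nat R) : (0 <= fine (r B) <= 1)%R by exact: fine_prob01.
move: (pr01 p) (pr01 q); rewrite ler_norml; lra.
Qed.

Definition EnvSpace (R : realType) := g_sigma_algebraType (@Delta_open R).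

(** A functional that is 1-Lipschitz for the component-wise total variation
    distance has open strict superlevel sets. *)
Lemma measurable_tv_lipschitz (R : realType) (phi : EnvSpace R -> R) :
  (forall q q' : Delta R, (`|phi q - phi q'|
     <= Num.max (tv_dist q.1 q'.1) (tv_dist q.2 q'.2))%R) ->
  measurable_fun [set: EnvSpace R] phi.
Proof.
move=> lip.
apply: (measurability _ (RGenOInfty.measurableE R)) => _ [_ [a ->] <-].
rewrite setTI; apply: sub_sigma_algebra => q /=.
rewrite in_itv/= andbT => aq; exists (phi q - a)%R; first by rewrite subr_gt0.
move=> q' q1 q2; rewrite /= in_itv/= andbT.
have := le_lt_trans (lip q q') (_ : _ < phi q - a)%R.
rewrite gt_max q1 q2 => /(_ isT); rewrite ltr_norml => /andP[_]; lra.
Qed.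

Lemma measurable_offspring (R : realType) (A : set nat) :
  measurable_fun [set: EnvSpace R] (fun q : EnvSpace R => fine (q.1 A)).
Proof.
apply: measurable_tv_lipschitz => q q'.
by rewrite le_max tv_dist_ge.
Qed.

Lemma measurable_immigration (R : realType) (A : set nat) :
  measurable_fun [set: EnvSpace R] (fun q : EnvSpace R => fine (q.2 A)).
Proof.
apply: measurable_tv_lipschitz => q q'.
by rewrite le_max tv_dist_ge orbT.
Qed.

Lemma measurable_env (R : realType) (d : measure_display)
    (T : measurableType d) (Q : T -> Delta R) : random_env Q ->
  measurable_fun setT (Q : T -> EnvSpace R).
Proof. by move=> mQ _ B mB; rewrite setTI; exact: mQ. Qed.

(** Starting from the product rule for events, the factors are turned one
    after the other from indicators into arbitrary functions; at each step
    the other factors make up a fixed weight. *)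
Lemma env_expectation_prod (R : realType) (d : measure_display)
    (T : measurableType d) (P : probability T R) (Q : T -> Delta R)
    (Qn : nat -> T -> Delta R) (phi : nat -> EnvSpace R -> R) (m : nat) :
  random_env Q -> independent_copies P Q Qn ->
  (forall n, measurable_fun setT (phi n)) ->
  (forall n q, 0 <= phi n q <= 1)%R ->
  \int[P]_w (\prod_(n < m) phi n (Qn n w))%:E =
  \prod_(n < m) \int[P]_w (phi n (Q w))%:E.
Proof.
move=> mQ [mQn eqQ indQ] mphi phi01.
have mQ' := measurable_env _ _ _ _ mQ.
have mQn' n := measurable_env _ _ _ _ (mQn n).
suff claim s : forall psi : nat -> EnvSpace R -> R,
    (forall n, measurable_fun setT (psi n)) ->
    (forall n q, 0 <= psi n q <= 1)%R ->
    (forall n, (s <= n)%N -> exists2 B, measurable B & psi n = \1_B) ->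
    \int[P]_w (\prod_(n < m) psi n (Qn n w))%:E =
    \prod_(n < m) \int[P]_w (psi n (Q w))%:E.
  pose psi n := if (n < m)%N then phi n else \1_setT.
  have := claim m psi.
  rewrite (eq_integral (fun w => (\prod_(n < m) phi n (Qn n w))%:E)); last first.
    by move=> w _; congr EFin; apply: eq_bigr => i _; rewrite /psi ltn_ord.
  move=> -> //.
  - by apply: eq_bigr => i _; rewrite /psi ltn_ord.
  - by move=> n; rewrite /psi; case: ifP.
  - by move=> n q; rewrite /psi; case: ifP => //; rewrite indicT lexx ler01.
  - by move=> n mn; exists setT => //; rewrite /psi ltnNge mn.
elim: s => [|s IH] psi mpsi psi01 psiB.
  have /choice[B HB] n : exists B, measurable B /\ psi n = \1_B.
    by have [B ? ?] := psiB n isT; exists B.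
  pose J : {fset nat} := [fset i | i in iota 0 m]%fset.
  have perm : perm_eq J (iota 0 m).
    apply: uniq_perm; rewrite ?iota_uniq ?fset_uniq// => i.
    by rewrite !inE.
  have mB n : measurable (Qn n @^-1` B n) by apply: mQn; exact: (HB n).1.
  transitivity (P (\bigcap_(n in [set` J]) (Qn n @^-1` B n))).
    rewrite -[X in P X]setIT -integral_indic//; last first.
      exact: fin_bigcap_measurable.
    apply: eq_integral => w _; congr EFin.
    under eq_bigr do rewrite (HB _).2.
    rewrite indicE; case: (boolP (w \in _)); rewrite ?inE ?notin_setE => hw.
      apply: big1 => i _; rewrite indicE mem_set//; apply: hw => /=.
      by rewrite (perm_mem perm) mem_iota/=.
    have [i /not_implyP[iJ nB]] : exists i, ~ ([set` J] i -> (Qn i @^-1` B i) w).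
      exact/existsNP.
    move: iJ; rewrite /= (perm_mem perm) mem_iota/= add0n => im.
    by rewrite (bigD1 (Ordinal im))//= indicE memNset ?mul0r.
  rewrite indQ; last by move=> n; exact: (HB n).1.
  rewrite (perm_big _ perm)/= -{1}(subn0 m) -/(index_iota 0 m) big_mkord.
  apply: eq_bigr => n _; rewrite eqQ; last exact: (HB n).1.
  rewrite -[X in P X]setIT -integral_indic//; last by apply: mQ; exact: (HB n).1.
  by apply: eq_integral => w _; rewrite (HB n).2.
have [ms|sm] := leqP m s.
  (* The factor with index [s] lies outside the product. *)
  have := IH (fun n => if (n < s)%N then psi n else \1_setT).
  rewrite (eq_integral (fun w => (\prod_(n < m) psi n (Qn n w))%:E)); last first.
    move=> w _; congr EFin; apply: eq_bigr => i _.
    by rewrite (leq_trans (ltn_ord i) ms).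
  move=> -> //.
  - by apply: eq_bigr => i _; rewrite (leq_trans (ltn_ord i) ms).
  - by move=> n; case: ifP.
  - by move=> n q; case: ifP => //; rewrite indicT lexx ler01.
  - by move=> n mn; exists setT => //; rewrite ltnNge mn.
pose s' := Ordinal sm.
pose g w := (\prod_(n < m | n != s') psi n (Qn n w))%R.
pose c := \prod_(n < m | n != s') \int[P]_w (psi n (Q w))%:E.
have cfin : c \is a fin_num.
  apply: prode_fin_num => i _; apply: integral01_fin_num => //.
  exact: (measurableT_comp (mpsi i)).
rewrite (bigD1 s')//= -/c muleC -(fineK cfin).
transitivity (\int[P]_w ((g w)%:E * (psi s (Qn s w))%:E)).
  by apply: eq_integral => w _; rewrite (bigD1 s')//= mulrC EFinM.
rewrite (@integral_mul_comp R _ _ _ _ P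
  (pushforward P (Q : T -> EnvSpace R)) (Qn s) g (fine c) _ _ _ _
  (fun q => (psi s q)%:E))//.
- rewrite ge0_integral_pushforward//; last 1 first.
  + by move=> q _; rewrite lee_fin; case/andP: (psi01 s q).
  by apply/measurable_EFinP.
- rewrite /g; under eq_fun do rewrite -big_filter.
  by apply: measurable_prod => i _; exact: (measurableT_comp (mpsi i)).
- by move=> w; apply: prodr_ge0 => i _; case/andP: (psi01 i (Qn i w)).
- move=> B mB.
  have := IH (fun n => if n == s then \1_B else psi n).
  rewrite (bigD1 s')//= eqxx muleC.
  rewrite (eq_bigr (fun i : 'I_m => \int[P]_w (psi i (Q w))%:E)); last first.
    by move=> i /negPf; rewrite -val_eqE/= => ->.
  rewrite -/c fineK// => {}IH.
  transitivity (\int[P]_w (\prod_(n < m)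
      (if n == s :> nat then \1_B else psi n) (Qn n w))%:E).
    apply: eq_integral => w _; rewrite [in RHS](bigD1 s')//= eqxx mulrC EFinM.
    congr (_%:E * _); apply: eq_bigr => i /negPf.
    by rewrite -val_eqE/= => ->.
  rewrite IH.
  + congr (_ * _); rewrite -[X in _ = _ X]setIT /pushforward.
    by rewrite integral_indic//; exact: mQ.
  + by move=> n; case: ifP => // _; exact: measurable_indic.
  + move=> n q; case: ifP => // _; rewrite indicE.
    by case: (_ \in _); rewrite ?lexx ?ler01.
  + move=> n sn; case: ifP => [_|ns]; first by exists B.
    by apply: psiB; rewrite ltn_neqAle eq_sym ns.
- by move=> q; rewrite lee_fin; case/andP: (psi01 s q).
- exact/measurable_EFinP.
Qed.

(** * Quenched transition probabilities *)

Definition mass (R : realType) (p : probability nat R) (j : nat) : R :=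
  fine (p [set j]).

(** The quenched one-step transition probabilities: the [k]-fold convolution
    of the offspring law, convolved with the immigration law. *)
Fixpoint quenched (R : realType) (q : Delta R) (k j : nat) : R :=
  match k with
  | 0%N => mass R q.2 j
  | k'.+1 => (\sum_(a < j.+1) mass R q.1 a * quenched R q k' (j - a))%R
  end.

Definition annealed (R : realType) (d : measure_display)
    (T : measurableType d) (P : probability T R) (X : T -> Delta R)
    (k j : nat) : \bar R := \int[P]_w (quenched R (X w) k j)%:E.

Lemma mass01 (R : realType) (p : probability nat R) (j : nat) :
  (0 <= mass R p j <= 1)%R.
Proof. exact: fine_prob01. Qed.

Lemma mass_ge0 (R : realType) (p : probability nat R) (j : nat) :
  (0 <= mass R p j)%R.
Proof. by case/andP: (mass01 R p j). Qed.

Lemma sum_mass_le1 (R : realType) (p : probability nat R) (n : nat) :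
  (\sum_(j < n) mass R p j <= 1)%R.
Proof.
rewrite -lee_fin -sumEFin.
under eq_bigr do rewrite fineK ?fin_num_measure//.
have := @measure_fibers_ord R _ _ p id (`I_n) n.
rewrite (eq_bigr (fun a : 'I_n => p [set (a : nat)])); last first.
  by move=> a _; congr (_ _); apply/seteqP; split => [x []//|x /= ->]; split => //=.
move=> <- //; exact: probability_le1.
Qed.

Lemma quenched_ge0 (R : realType) (q : Delta R) (k j : nat) :
  (0 <= quenched R q k j)%R.
Proof.
elim: k j => [|k IH] j /=; first exact: mass_ge0.
by apply: sumr_ge0 => a _; rewrite mulr_ge0// mass_ge0.
Qed.

Lemma measurable_quenched (R : realType) (k j : nat) :
  measurable_fun [set: EnvSpace R] (fun q : EnvSpace R => quenched R q k j).
Proof.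
elim: k j => [|k IH] j /=; first exact: measurable_immigration.
apply: measurable_sum => a; apply: measurable_funM; last exact: IH.
exact: measurable_offspring.
Qed.

(** The inequality half of the Cauchy product formula, for partial sums. *)
Lemma triangle_le_rectangle (R : realType) (u v : nat -> R) (J : nat) :
  (forall i, 0 <= u i)%R -> (forall i, 0 <= v i)%R ->
  (\sum_(j < J) \sum_(a < j.+1) u a * v (j - a)%N
    <= (\sum_(a < J) u a) * \sum_(i < J) v i)%R.
Proof.
move=> u0 v0.
have -> : (\sum_(j < J) \sum_(a < j.+1) u a * v (j - a)%N =
    \sum_(a < J) \sum_(j < J | (a <= j)%N) u a * v (j - a)%N)%R.
  under eq_bigr => j _.
    rewrite (big_ord_widen J (fun a => u a * v (j - a)%N)%R) ?ltn_ord//.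
    rewrite big_mkcond/=; over.
  rewrite exchange_big/=; apply: eq_bigr => a _.
  rewrite [RHS]big_mkcond/=; apply: eq_bigr => j _.
  by rewrite ltnS.
rewrite mulr_suml; apply: ler_sum => a _; rewrite -mulr_sumr.
rewrite ler_wpM2l//.
rewrite -(big_mkord (fun j => (a <= j)%N) (fun j => v (j - a)%N)).
rewrite (big_cat_nat (leq0n a) (ltnW (ltn_ord a)))/=.
rewrite big_nat_cond big_pred0 ?add0r; last first.
  by move=> i /=; rewrite ltnNge; case: (a <= i)%N; rewrite ?andbF.
rewrite -{1}[(a : nat)]add0n big_addn.
rewrite -(big_mkord xpredT v) [leRHS](big_cat_nat (leq0n (J - a)) (leq_subr a J))/=.
rewrite -[leLHS]addr0 lerD//; last exact: sumr_ge0.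
rewrite big_mkcond/=; apply: ler_sum => i _.
by rewrite addnK; case: ifP.
Qed.
(** Generating functions turn convolution into multiplication; that of the
    immigration law is at most [1]. *)
Lemma sum_quenched_exp_le (R : realType) (q : Delta R) (x : R) (k J : nat) :
  (0 <= x <= 1)%R ->
  (\sum_(j < J) quenched R q k j * x ^+ j
    <= (\sum_(a < J) mass R q.1 a * x ^+ a) ^+ k)%R.
Proof.
move=> /andP[x0 x1]; have xn0 n : (0 <= x ^+ n)%R by exact: exprn_ge0.
elim: k => [|k IH].
  rewrite expr0 (le_trans _ (sum_mass_le1 R q.2 J))//; apply: ler_sum => j _.
  by rewrite ler_piMr// ?mass_ge0// exprn_ile1.
rewrite exprS.
apply: le_trans (_ : _ <= (\sum_(a < J) mass R q.1 a * x ^+ a) *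
    \sum_(j < J) quenched R q k j * x ^+ j)%R _; last first.
  by apply: ler_wpM2l => //; apply: sumr_ge0 => a _; rewrite mulr_ge0// mass_ge0.
apply: le_trans (triangle_le_rectangle R (fun a => mass R q.1 a * x ^+ a)%R
  (fun i => quenched R q k i * x ^+ i)%R J _ _); last 2 first.
- by move=> a; rewrite mulr_ge0// mass_ge0.
- by move=> a; rewrite mulr_ge0// quenched_ge0.
apply: ler_sum => j _ /=; rewrite mulr_suml; apply: ler_sum => a _.
have aj : (a <= j)%N by rewrite -ltnS.
by rewrite mulrACA -exprD subnKC.
Qed.

Lemma sum_quenched_le1 (R : realType) (q : Delta R) (k J : nat) :
  (\sum_(j < J) quenched R q k j <= 1)%R.
Proof.
have := sum_quenched_exp_le R q 1 k J.
rewrite ler01 lexx => /(_ isT).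
under eq_bigr do rewrite expr1n mulr1.
under [X in (_ <= X ^+ _)%R -> _]eq_bigr do rewrite expr1n mulr1.
move=> /le_trans; apply; rewrite exprn_ile1 ?sum_mass_le1//.
by apply: sumr_ge0 => a _; exact: mass_ge0.
Qed.

Lemma quenched01 (R : realType) (q : Delta R) (k j : nat) :
  (0 <= quenched R q k j <= 1)%R.
Proof.
rewrite quenched_ge0/=; apply: le_trans (sum_quenched_le1 R q k j.+1).
rewrite big_ord_recr/= lerDr; apply: sumr_ge0 => i _; exact: quenched_ge0.
Qed.

(** One scenario: the [k] individuals have [a 0], ..., [a k.-1] children and
    [y] immigrants arrive. *)
Lemma quenched_ge (R : realType) (q : Delta R) (a : nat -> nat) (k y : nat) :
  (mass R q.2 y * \prod_(i < k) mass R q.1 (a i)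
    <= quenched R q k (\sum_(i < k) a i + y))%R.
Proof.
elim: k => [|k IH]; first by rewrite !big_ord0 mulr1.
rewrite [in leRHS]big_ord_recr [in leLHS]big_ord_recr/= mulrA [leLHS]mulrC.
set s := (\sum_(i < k) a i)%N in IH *.
have ak : (a k < (s + a k + y).+1)%N by rewrite ltnS -addnA addnCA leq_addr.
rewrite (bigD1 (Ordinal ak))//= (_ : (s + a k + y - a k)%N = (s + y)%N); last first.
  by rewrite addnAC addnK.
rewrite -[leLHS]addr0 lerD//.
- by rewrite ler_wpM2l// mass_ge0.
- by apply: sumr_ge0 => i _; rewrite mulr_ge0// ?mass_ge0// quenched_ge0.
Qed.

(** * The annealed Markov chain *)

Fixpoint iter_kernel (R : realType) (K : nat -> nat -> \bar R) (n k j : nat)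
    : \bar R :=
  match n with
  | 0%N => (k == j)%:R%:E
  | n'.+1 => \sum_(0 <= i <oo) iter_kernel R K n' k i * K i j
  end.

Lemma iter_kernel_ge0 (R : realType) (K : nat -> nat -> \bar R) :
  (forall k j, 0 <= K k j) -> forall n k j, 0 <= iter_kernel R K n k j.
Proof.
move=> K0; elim=> [|n IH] k j /=; first by rewrite lee_fin.
by apply: nneseries_ge0 => i _ _; rewrite mule_ge0.
Qed.

Definition rect (T : Type) (N : nat -> nat -> T -> nat) (Y : nat -> T -> nat)
    (r n : nat) (A : nat -> set nat) (C : set nat) : set T :=
  Y n @^-1` C `&` \bigcap_(i < r) (N n i @^-1` A i).

Definition rect_mass (R : realType) (r : nat) (A : nat -> set nat)
    (C : set nat) (q : Delta R) : R :=
  (fine (q.2 C) * \prod_(i < r) fine (q.1 (A i)))%R.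

Lemma rect_mass01 (R : realType) (r : nat) (A : nat -> set nat)
    (C : set nat) (q : Delta R) : (0 <= rect_mass R r A C q <= 1)%R.
Proof.
have pr01 (p : probability nat R) B : (0 <= fine (p B) <= 1)%R by exact: fine_prob01.
have ge0 : (0 <= \prod_(i < r) fine (q.1 (A i)))%R.
  by apply: prodr_ge0 => i _; case/andP: (pr01 q.1 (A i)).
have le1 : (\prod_(i < r) fine (q.1 (A i)) <= 1)%R by apply: prodr_ile1 => i _.
have /andP[p0 p1] := pr01 q.2 C.
by rewrite mulr_ge0//= mulr_ile1.
Qed.

Lemma measurable_rect_mass (R : realType) (r : nat) (A : nat -> set nat)
    (C : set nat) :
  measurable_fun [set: EnvSpace R] (fun q : EnvSpace R => rect_mass R r A C q).
Proof.
apply: measurable_funM; first exact: measurable_immigration.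
by apply: measurable_prod => i _; exact: measurable_offspring.
Qed.

(** Rectangles of different widths are compared by adding trivial
    constraints. *)
Lemma rect_pad (T : Type) (N : nat -> nat -> T -> nat) (Y : nat -> T -> nat)
    (r r' n : nat) (A : nat -> set nat) (C : set nat) : (r <= r')%N ->
  rect T N Y r n A C =
  rect T N Y r' n (fun i => if (i < r)%N then A i else setT) C.
Proof.
move=> rr'; rewrite /rect; congr (_ `&` _); apply/seteqP; split => w Hw i /= ir.
  by case: ifPn => // /(Hw i).
by have /= := Hw i (leq_trans ir rr'); rewrite ir.
Qed.

Lemma rect_mass_pad (R : realType) (r r' : nat) (A : nat -> set nat)
    (C : set nat) (q : Delta R) : (r <= r')%N ->
  rect_mass R r A C q =
  rect_mass R r' (fun i => if (i < r)%N then A i else setT) C q.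
Proof.
move=> rr'; rewrite /rect_mass; congr (_ * _)%R.
rewrite (big_ord_widen _ (fun i => fine (q.1 (A i))) rr') big_mkcond/=.
apply: eq_bigr => i _; case: ifP => // _.
by rewrite probability_setT.
Qed.

Section branching_chain.
Context (R : realType) (d : measure_display) (T : measurableType d)
  (P : probability T R) (Q : T -> Delta R) (Qn : nat -> T -> Delta R)
  (N : nat -> nat -> T -> nat) (Y : nat -> T -> nat).
Hypothesis hZ : branching_data P Q Qn N Y.

Notation rect := (rect T N Y).
Notation Erect r A C := (\int[P]_w (rect_mass R r A C (Q w))%:E).

Let mQ : measurable_fun setT (Q : T -> EnvSpace R).
Proof. by apply: measurable_env; exact: bd_env hZ. Qed.

Let measurable_family (n k : nat) :
  measurable_fun setT (fun w => (\sum_(l < k) N n l w + Y n w)%N).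
Proof.
elim: k => [|k IH]; first by under eq_fun do rewrite big_ord0; exact: bd_immigrants_meas hZ _.
under eq_fun do rewrite big_ord_recr/= addnAC.
apply: measurable_fun_addn; [exact: IH|exact: bd_offspring_meas hZ _ _].
Qed.

Lemma measurable_rect r n A C : measurable (rect r n A C).
Proof.
apply: measurableI; first by apply: measurable_preimage => //; exact: bd_immigrants_meas hZ _.
rewrite bigcap_mkord; apply: bigsetI_measurable => i _.
by apply: measurable_preimage => //; exact: bd_offspring_meas hZ _ _.
Qed.

Lemma measurable_bpire k n : measurable_fun setT (bpire N Y k n).
Proof.
elim: n => [|n IH] /=; first exact: measurable_cst.
move=> _ B _; rewrite setTI.
rewrite (_ : _ @^-1` B = \bigcup_i ((bpire N Y k n) @^-1` [set i] `&`
    (fun w => (\sum_(l < i) N n l w + Y n w)%N) @^-1` B)).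
  apply: bigcup_measurable => i _; apply: measurableI; apply: measurable_preimage => //.
by apply/seteqP; split => [w Bw|w [i _ [/= <-]]]//; exists (bpire N Y k n w).
Qed.

(** The variables of one generation are only conditionally independent, but
    different generations are independent under the averaged law. *)
Lemma rect_probability r (A : nat -> nat -> set nat) (C : nat -> set nat) m :
  P (\bigcap_(n < m) rect r n (A n) (C n)) = \prod_(n < m) Erect r (A n) (C n).
Proof.
have := bd_quenched hZ (E := setT) m r A C.
rewrite setTI => ->; last by rewrite -setC0 -setTD; apply: sigma_algebraCD; exact: sigma_algebra0.
rewrite -(@env_expectation_prod _ _ _ P Q Qn (fun n => rect_mass R r (A n) (C n)) m); last 4 first.
- exact: bd_env hZ.
- exact: bd_copies hZ.
- by move=> n; exact: measurable_rect_mass.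
- by move=> n q; exact: rect_mass01.
apply: eq_integral => w _; rewrite -prodEFin; apply: eq_bigr => n _.
rewrite /rect_mass EFinM -prodEFin fineK ?fin_num_measure//.
by congr (_ * _); apply: eq_bigr => i _; rewrite fineK// fin_num_measure.
Qed.

(** If an event is independent of every rectangle of generation [n], then it
    is independent of the sum of [k] offspring numbers and the immigrants:
    this sum is resolved by fixing one offspring number after the other. *)
Lemma family_probability (W : set T) (c : R) (n r k j : nat) :
  measurable W -> (k <= r)%N ->
  (forall A C, P (W `&` rect r n A C) = c%:E * Erect r A C) ->
  P (W `&` [set w | (\sum_(l < k) N n l w + Y n w)%N = j]) =
    c%:E * annealed R d T P Q k j.
Proof.
move=> mW kr HW.
pose rest k (A : nat -> set nat) := \bigcap_(i in [set i | (k <= i < r)%N]) (N n i @^-1` A i).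
have mrest k' A : measurable (rest k' A).
  apply: fin_bigcap_measurable => [|i _].
    by apply: (sub_finite_set _ (finite_II r)) => i /= /andP[].
  by apply: measurable_preimage => //; exact: bd_offspring_meas hZ _ _.
suff claim : forall A, P (W `&` [set w | (\sum_(l < k) N n l w + Y n w)%N = j] `&` rest k A)
    = c%:E * \int[P]_w (quenched R (Q w) k j *
                        \prod_(k <= i < r) fine ((Q w).1 (A i)))%:E.
  have := claim (fun=> setT); rewrite /rest/= (_ : \bigcap_(i in _) _ = setT); last first.
    by apply/seteqP; split.
  rewrite setIT => ->; congr (_ * _); apply: eq_integral => w _.
  by rewrite big1 ?mulr1// => i _; rewrite probability_setT.
elim: k j kr => [|k IH] j kr A.
  rewrite -setIA (_ : _ `&` rest 0%N A = rect r n A [set j]); last first.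
    rewrite /rect /rest; apply/seteqP; split => w [/= H1 H2]; split => //.
    - by move: H1; rewrite big_ord0.
    - by move: H1; rewrite big_ord0 add0n.
  rewrite HW; congr (_ * _); apply: eq_integral => w _.
  by rewrite /rect_mass/= big_mkord.
rewrite (@measure_fibers_ord _ _ _ P (N n k) _ j.+1); last 3 first.
- exact: bd_offspring_meas hZ _ _.
- apply: measurableI => //; apply: measurableI => //.
  exact: (measurable_preimage _ _ _ _ _ [set j] (measurable_family n k.+1)).
- by move=> w [[_ /= <-] _]; rewrite ltnS big_ord_recr/= addnAC leq_addl.
rewrite (eq_bigr (fun a : 'I_j.+1 => c%:E * \int[P]_w (mass R (Q w).1 a *
   quenched R (Q w) k (j - a) * \prod_(k.+1 <= i < r) fine ((Q w).1 (A i)))%:E)).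
  rewrite -ge0_sume_distrr; last first.
    move=> a _; apply: integral_ge0 => w _; rewrite lee_fin.
    rewrite !mulr_ge0// ?mass_ge0 ?quenched_ge0//.
    by apply: prodr_ge0 => i _; exact: fine_ge0.
  congr (_ * _); rewrite -ge0_integral_sum//.
  - by apply: eq_integral => w _; rewrite /= sumEFin -mulr_suml.
  - move=> a; apply/measurable_EFinP; apply: measurable_funM.
      apply: measurable_funM; first exact: (measurableT_comp (measurable_offspring R _) mQ).
      exact: (measurableT_comp (measurable_quenched R k _) mQ).
    by apply: measurable_prod => i _; exact: (measurableT_comp (measurable_offspring R _) mQ).
  - move=> a w _; rewrite lee_fin.
    rewrite !mulr_ge0// ?mass_ge0 ?quenched_ge0//.
    by apply: prodr_ge0 => i _; exact: fine_ge0.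
move=> a _.
have := IH (j - a)%N (ltnW kr) (fun i => if i == k then [set (a : nat)] else A i).
rewrite (_ : _ `&` rest k _ = W `&` [set w | (\sum_(l < k.+1) N n l w + Y n w)%N = j]
    `&` rest k.+1 A `&` N n k @^-1` [set (a : nat)]).
  move=> Hk; etransitivity; first exact: Hk.
  congr (_ * _); apply: eq_integral => w _; congr EFin.
  rewrite big_ltn// eqxx mulrCA mulrA; congr (_ * _)%R.
  rewrite big_nat [RHS]big_nat; apply: eq_bigr => i /andP[ki _].
  by rewrite gtn_eqF.
apply/seteqP; split => w.
- move=> [[Ww /= Hs] Hr].
  have Nk : N n k w = a by have /= := Hr k; rewrite leqnn kr eqxx; exact.
  split => //; split; first split => //.
  + by rewrite big_ord_recr/= Nk addnAC Hs subnK// -ltnS.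
  + move=> i /= /andP[ki ir]; have /= := Hr i.
    by rewrite gtn_eqF// (ltnW ki) ir; exact.
- move=> [[[Ww /= Hs] Hr] /= Nk]; split; first split => //=.
  + by move: Hs; rewrite big_ord_recr/= Nk addnAC => Hs;
      rewrite -[LHS](addnK (a : nat)) Hs.
  + move=> i /= /andP[ki ir]; case: eqP => [->//|/eqP ik].
    by apply: Hr => /=; rewrite ir ltn_neqAle eq_sym ik ki.
Qed.

Notation pn := (iter_kernel R (annealed R d T P Q)).

Lemma annealed_ge0 k j : 0 <= annealed R d T P Q k j.
Proof. by apply: integral_ge0 => w _; rewrite lee_fin quenched_ge0. Qed.

Let iter_annealed_ge0 n k j : 0 <= pn n k j.
Proof. exact: iter_kernel_ge0 annealed_ge0 n k j. Qed.

Let Erect_fin r A C : Erect r A C \is a fin_num.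
Proof.
apply: integral01_fin_num; last by move=> w; exact: rect_mass01.
exact: (measurableT_comp (measurable_rect_mass R r A C) mQ).
Qed.

(** The law of generation [n], jointly with rectangles of later generations:
    the later rectangles are what makes the induction go through, since they
    supply the variables that turn generation [n] into generation [n.+1]. *)
Lemma bpire_law_future k n : forall m r (A : nat -> nat -> set nat)
    (C : nat -> set nat) j,
  P (bpire N Y k n @^-1` [set j] `&`
     \bigcap_(l in [set l | (n <= l < m)%N]) rect r l (A l) (C l)) =
  pn n k j * \prod_(n <= l < m) Erect r (A l) (C l).
Proof.
elim: n => [|n IH] m r A C j.
  rewrite /= big_mkord -rect_probability.
  case: eqVneq => [->|kj].
    rewrite mul1e (_ : (fun=> j) @^-1` [set j] = setT) ?setTI//.
    by apply/seteqP; split.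
  rewrite mul0e (_ : _ `&` _ = set0) ?measure0//.
  by apply/seteqP; split => // w [/= kj' _]; rewrite kj' eqxx in kj.
pose slab := \bigcap_(l in [set l | (n < l < m)%N]) rect r l (A l) (C l).
have mslab : measurable slab.
  apply: fin_bigcap_measurable => [|i _]; last exact: measurable_rect.
  by apply: (sub_finite_set _ (finite_II m)) => i /= /andP[].
pose Pi := \prod_(n.+1 <= l < m) Erect r (A l) (C l).
have Pi_fin : Pi \is a fin_num by apply: prode_fin_num => i _; exact: Erect_fin.
have pn_fin i : pn n k i \is a fin_num.
  have := IH n r A C i; rewrite [X in _ = _ * X]big_geq// mule1 => <-.
  rewrite fin_num_measure//; apply: measurableI.
    exact: (measurable_preimage _ _ _ _ _ [set i] (measurable_bpire k n)).
  apply: fin_bigcap_measurable => [|l _]; last exact: measurable_rect.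
  by apply: (sub_finite_set _ (finite_II n)) => l /= /andP[].
rewrite (@measure_fibers _ _ _ P (bpire N Y k n)); last 2 first.
- exact: measurable_bpire.
- by apply: measurableI => //; exact: (measurable_preimage _ _ _ _ _ [set j] (measurable_bpire k n.+1)).
transitivity (\sum_(0 <= i <oo) (fine Pi)%:E * (pn n k i * annealed R d T P Q i j)); last first.
  rewrite nneseriesZl; last by move=> i _; rewrite mule_ge0// ?annealed_ge0 ?iter_annealed_ge0.
  by rewrite fineK// muleC.
apply: eq_eseriesr => i _.
rewrite [RHS](_ : _ = (fine (pn n k i * Pi))%:E * annealed R d T P Q i j); last first.
  by rewrite !fineK ?fin_numM// muleA [Pi * _]muleC.
rewrite -(@family_probability (bpire N Y k n @^-1` [set i] `&` slab)
  (fine (pn n k i * Pi)) n (maxn r i) i j _ (leq_maxr r i)); last 2 first.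
- by apply: measurableI => //; exact: (measurable_preimage _ _ _ _ _ [set i] (measurable_bpire k n)).
- move=> A0 C0; rewrite fineK ?fin_numM//.
  pose A' l := if l == n then A0 else (fun i => if (i < r)%N then A l i else setT).
  pose C' l := if l == n then C0 else C l.
  have := IH (maxn m n.+1) (maxn r i) A' C' i.
  rewrite [X in _ = _ * X]big_ltn ?leq_maxr// {1 2}/A' {1 2}/C' eqxx.
  rewrite (_ : \prod_(n.+1 <= l < maxn m n.+1) _ = Pi); last first.
    rewrite /Pi; have [mn|nm] := leqP m n.+1; first by rewrite !big_geq.
    rewrite big_nat [RHS]big_nat; apply: eq_bigr => l /andP[nl _].
    rewrite /A' /C' gtn_eqF//; apply: eq_integral => w _; congr EFin.
    by rewrite -rect_mass_pad// leq_maxl.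
  rewrite muleA muleAC => <-; congr (P _).
  rewrite -setIA; congr (_ `&` _); apply/seteqP; split => w.
    move=> [Hs Hr] l /= /andP[nl lm]; rewrite /A' /C'.
    have [->//|ln] := eqVneq l n.
    have nl' : (n < l)%N by rewrite ltn_neqAle eq_sym ln nl.
    rewrite -rect_pad ?leq_maxl//; apply: Hs => /=; rewrite nl'/=.
    by move: lm; rewrite leq_max [X in _ || X]ltnS [X in _ || X]leqNgt nl' orbF.
  move=> H; split => [l /= /andP[nl lm]|].
    have /= := H l; rewrite (ltnW nl) leq_max lm /A' /C' gtn_eqF// => /(_ isT).
    by rewrite -rect_pad// leq_maxl.
  by have /= := H n; rewrite leqnn leq_maxr /A' /C' eqxx => /(_ isT).
congr (P _); apply/seteqP; split => w.
  by move=> [[/= Hj Hs] Hi]; move: Hj; rewrite Hi.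
by move=> [[/= Hi Hs] Hj]; split => //; split => //=; rewrite Hi.
Qed.

Lemma bpire_law k n j :
  P [set w | bpire N Y k n w = j] = pn n k j.
Proof.
have := bpire_law_future k n n 0 (fun _ _ => setT) (fun=> setT) j.
rewrite big_geq// mule1 => <-; congr (P _); apply/seteqP; split => [w Zj|w []//].
by split => // l /= /andP[nl ln]; rewrite ltnNge nl in ln.
Qed.

Lemma measurable_bpire_set k n (B : set nat) : measurable [set w | B (bpire N Y k n w)].
Proof. exact: (measurable_preimage _ _ _ _ _ B (measurable_bpire k n)). Qed.

End branching_chain.

(** The environment of the first generation has the law of [Q]. *)
Lemma branching_data_env0 (R : realType) (d : measure_display)
    (T : measurableType d) (P : probability T R) (Q : T -> Delta R)
    (Qn : nat -> T -> Delta R) (N : nat -> nat -> T -> nat)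
    (Y : nat -> T -> nat) :
  branching_data P Q Qn N Y -> branching_data P (Qn 0%N) Qn N Y.
Proof.
case=> mQ [mQn eqQ indQ] mN mY q; split=> //; split=> // n B mB.
by rewrite !eqQ.
Qed.

(** * Iterated kernels and Lyapunov functions *)

Section kernel_iterates.
Context (R : realType) (K : nat -> nat -> \bar R).
Hypothesis K0 : forall k j, 0 <= K k j.
Hypothesis pn_fin : forall n k j, iter_kernel R K n k j \is a fin_num.

Notation pn := (iter_kernel R K).

Let pn_ge0 n k j : 0 <= pn n k j.
Proof. exact: iter_kernel_ge0. Qed.

Lemma iter_kernel_supermul n m k i j :
  pn n k i * pn m i j <= pn (n + m)%N k j.
Proof.
elim: m j => [|m IH] j.
  rewrite addn0 /=; case: eqVneq => [->|_]; first by rewrite mule1.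
  by rewrite mule0.
rewrite addnS /= -(fineK (pn_fin n k i)) -nneseriesZl; last first.
  by move=> l _; rewrite mule_ge0.
apply: lee_nneseries => [l _ _|l _].
  by rewrite !mule_ge0// lee_fin fine_ge0.
by rewrite muleA lee_wpmul2r// fineK.
Qed.

(** One application of the kernel costs a factor [gamma]; the sums over the
    intermediate and the final state are exchanged by Tonelli's theorem. *)
Lemma iter_kernel_lyapunov (V : nat -> R) (gamma : R) :
  (forall k, 0 <= V k)%R -> (0 <= gamma)%R ->
  (forall k J, \sum_(j < J) K k j * (V j)%:E <= (gamma * V k)%:E) ->
  forall n k, \sum_(0 <= j <oo) pn n k j * (V j)%:E <= (gamma ^+ n * V k)%:E.
Proof.
move=> V0 gamma0 KV; elim=> [|n IH] k.
  rewrite expr0 mul1r (_ : (fun N => _) = (fun N => \sum_(0 <= j < N) pn 0 k j * (V j)%:E))//.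
  apply: lime_le; first by apply: is_cvg_nneseries => j _ _; rewrite mule_ge0// lee_fin.
  apply: nearW => J; rewrite big_mkord.
  have [kJ|Jk] := ltnP k J.
    rewrite (bigD1 (Ordinal kJ))//= eqxx mul1e big1 ?adde0//.
    by move=> j; rewrite -val_eqE/= eq_sym => /negPf ->; rewrite mul0e.
  rewrite big1 ?lee_fin// => j _ /=; rewrite gtn_eqF ?mul0e//.
  exact: leq_trans (ltn_ord j) Jk.
have -> : \sum_(0 <= j <oo) pn n.+1 k j * (V j)%:E =
    \sum_(0 <= j <oo) \sum_(0 <= i <oo) pn n k i * (K i j * (V j)%:E).
  apply: eq_eseriesr => j _ /=; rewrite muleC -nneseriesZl; last first.
    by move=> i _; rewrite mule_ge0.
  by apply: eq_eseriesr => i _; rewrite muleC muleA.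
rewrite nneseries_interchange; last first.
  by move=> j i; rewrite !mule_ge0// lee_fin.
apply: le_trans (_ : _ <= \sum_(0 <= i <oo) gamma%:E * (pn n k i * (V i)%:E)) _.
  apply: lee_nneseries => [i _ _|i _].
    by apply: nneseries_ge0 => j _ _; rewrite !mule_ge0// lee_fin.
  rewrite -(fineK (pn_fin n k i)) nneseriesZl; last by move=> j _; rewrite mule_ge0// lee_fin.
  rewrite [leRHS]muleCA lee_wpmul2l ?lee_fin ?fine_ge0//.
  apply: lime_le; first by apply: is_cvg_nneseries => j _ _; rewrite mule_ge0// lee_fin.
  by apply: nearW => J; rewrite big_mkord -EFinM.
rewrite nneseriesZl; last by move=> i _; rewrite mule_ge0// lee_fin.
by rewrite exprS -mulrA EFinM lee_wpmul2l ?lee_fin.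
Qed.

Lemma iter_kernel_decay (V : nat -> R) (gamma : R) :
  (forall k, 0 < V k)%R -> (0 <= gamma)%R ->
  (forall k J, \sum_(j < J) K k j * (V j)%:E <= (gamma * V k)%:E) ->
  forall n k, pn n k k <= (gamma ^+ n)%:E.
Proof.
move=> V0 gamma0 KV n k.
have V0' j : (0 <= V j)%R by exact: ltW.
have term0 j : (0 <= j)%N -> xpredT j -> 0 <= pn n k j * (V j)%:E.
  by move=> _ _; rewrite mule_ge0// lee_fin.
rewrite -(@lee_pmul2r _ (V k)%:E)// ?lte_fin// -EFinM.
apply: le_trans (iter_kernel_lyapunov V gamma V0' gamma0 KV n k).
apply: le_trans (nneseries_lim_ge k.+1 term0).
rewrite big_mkord big_ord_recr/= leeDr// sume_ge0// => j _.
by rewrite mule_ge0// lee_fin.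
Qed.
End kernel_iterates.

(** A decreasing function that contracts far from the origin is repaired on the
    finitely many remaining states.  There it is replaced by a concave function,
    the constant [V K0] minus a geometric sequence of large ratio: since the
    drops grow geometrically, the gain of the (possibly very unlikely) jump
    upwards outweighs what can be lost by jumping down. *)
Lemma lyapunov_repair (R : realType) (K : nat -> nat -> R) (V : nat -> R)
    (K0 : nat) (gamma : R) :
  (forall k j, 0 <= K k j)%R ->
  (forall k J, \sum_(j < J) K k j <= 1)%R ->
  (forall k, 0 < V k <= 1)%R ->
  (forall k l, (k <= l)%N -> V l <= V k)%R ->
  (V K0.+1 < V K0)%R ->
  (0 <= gamma < 1)%R ->
  (forall k J, (K0 < k)%N -> \sum_(j < J) K k j * V j <= gamma * V k)%R ->
  (forall k, (k <= K0)%N -> exists2 i, (k < i)%N & (0 < K k i)%R) ->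
  exists (W : nat -> R) (gamma' : R), [/\ (forall k, 0 < W k)%R,
    (0 <= gamma' < 1)%R &
    (forall k J, \sum_(j < J) K k j * W j <= gamma' * W k)%R].
Proof.
move=> Kge0 Kle1 V01 Vdec VK0 /andP[gamma0 gamma1] drift up.
have /choice[i_ Hi] : forall k, exists i, (k <= K0)%N -> (k < i)%N /\ (0 < K k i)%R.
  move=> k; have [kK|] := leqP k K0; last by exists 0%N.
  by have [i ? ?] := up k kK; exists i.
have Kle1' k i : (K k i <= 1)%R.
  apply: le_trans (Kle1 k i.+1); rewrite big_ord_recr/= lerDr.
  by apply: sumr_ge0.
have [p [p0 p1 pK]] : exists p : R, [/\ (0 < p)%R, (p <= 1)%R &
    forall k, (k <= K0)%N -> (p <= K k (i_ k))%R].
  exists (\big[Num.min/1%R]_(k < K0.+1) K k (i_ k)); split.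
  - by apply: lt_bigmin => // k _; have [] := Hi k (ltn_ord k).
  - exact: bigmin_le_id.
  - by move=> k kK; apply: (bigmin_le_cond _ (j := Ordinal (kK : (k < K0.+1)%N))).
(* With this ratio [p * r ^+ k.+1] is [2 * r ^+ k]: weighted by the lower
   bound [p] for the jumps upwards, each drop still exceeds the previous one.  The scale
   [eps] makes the geometric sequence meet [V] at [K0.+1]. *)
pose r := (2 / p)%R.
have pr : (p * r = 2)%R by rewrite /r mulrC divfK ?gt_eqF.
have r1 : (1 <= r)%R by rewrite ler_pdivlMr// mul1r (le_trans p1)// ler1n.
have rn1 n : (1 <= r ^+ n)%R by exact: exprn_ege1.
pose eps := ((V K0 - V K0.+1) / r ^+ K0.+1)%R.
have rpos : (0 < r ^+ K0.+1)%R by rewrite (lt_le_trans ltr01).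
have eps0 : (0 < eps)%R by rewrite divr_gt0// subr_gt0.
have epsr : (eps * r ^+ K0.+1 = V K0 - V K0.+1)%R by rewrite /eps divfK ?gt_eqF.
have epsrk k : (k <= K0.+1)%N -> (eps * r ^+ k <= V K0 - V K0.+1)%R.
  by move=> kK; rewrite -epsr ler_pM2l// ler_weXn2l.
have eps1 : (eps < 1)%R.
  have := epsrk 0%N isT; rewrite expr0 mulr1 => /le_lt_trans; apply.
  by have /andP[? ?] := V01 K0; have /andP[? ?] := V01 K0.+1; lra.
pose W k := if (k <= K0)%N then (V K0 - eps * r ^+ k)%R else V k.
have WV k : (W k <= V k)%R.
  rewrite /W; case: ifP => // kK; apply: le_trans (Vdec _ _ kK).
  by rewrite gerBl mulr_ge0 ?(ltW eps0)// (le_trans _ (rn1 k)).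
have W0 k : (0 < W k)%R.
  rewrite /W; case: ifP => kK; last by case/andP: (V01 k).
  have /andP[? _] := V01 K0.+1.
  by have := epsrk k (leqW kK); lra.
have W1 k : (W k <= 1)%R by apply: le_trans (WV k) _; case/andP: (V01 k).
have Wup k l : (k <= K0)%N -> (k < l)%N -> (W l <= V K0 - eps * r ^+ k.+1)%R.
  move=> kK kl; rewrite /W; case: ifP => lK.
    by rewrite lerB// ler_pM2l// ler_weXn2l.
  move/negbT: lK; rewrite -ltnNge => /Vdec; have := epsrk k.+1 kK; lra.
have W0max k : (W k <= V K0 - eps)%R.
  rewrite /W; case: ifP => kK; first by rewrite lerB// ler_pMr.
  move/negbT: kK; rewrite -ltnNge => /Vdec.
  by have := epsrk 0%N isT; rewrite expr0 mulr1; lra.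
exists W, (Num.max gamma (1 - eps))%R; split => //.
  rewrite le_max gamma0/= gt_max gamma1/=; lra.
move=> k J; have [Kk|kK] := ltnP K0 k.
  apply: le_trans (_ : _ <= gamma * V k)%R _.
    by apply: le_trans (drift k J Kk); apply: ler_sum => j _; rewrite ler_wpM2l.
  rewrite /W leqNgt Kk/= ler_wpM2r ?le_max ?lexx//.
  by case/andP: (V01 k) => /ltW.
apply: le_trans (_ : _ <= (1 - eps) * W k)%R _; last first.
  by rewrite ler_wpM2r ?le_max ?lexx ?orbT// ltW.
have [ki Ki0] := Hi k kK; set i := i_ k in ki Ki0.
pose J' := maxn J i.+1.
apply: le_trans (_ : _ <= \sum_(j < J') K k j * W j)%R _.
  rewrite (big_ord_widen J' (fun j => K k j * W j)%R) ?leq_maxl// big_mkcond/=.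
  by apply: ler_sum => j _; case: ifP => // _; rewrite mulr_ge0// ltW.
have iJ : (i < J')%N by rewrite leq_max ltnSn orbT.
have := Kle1 k J'; rewrite (bigD1 (Ordinal iJ))//=.
set S := (\sum_(j < J' | _) K k j)%R => S1.
rewrite (bigD1 (Ordinal iJ))//=.
have S0 : (0 <= S)%R by apply: sumr_ge0.
apply: le_trans (_ : _ <= K k i * (V K0 - eps * r ^+ k.+1) + S * (V K0 - eps))%R _.
  rewrite lerD//; first by rewrite ler_wpM2l// Wup.
  by rewrite mulr_suml; apply: ler_sum => j _; rewrite ler_wpM2l.
have pKi := pK k kK; rewrite -/i in pKi.
have Wk : W k = (V K0 - eps * r ^+ k)%R by rewrite /W kK.
have top0 : (0 <= V K0 - eps)%R by apply: le_trans (W0max 0%N); exact: ltW.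
have rk := rn1 k; have rk1 := rn1 k.+1.
apply: le_trans (_ : _ <= (V K0 - eps) - p * (eps * (r ^+ k.+1 - 1)))%R _.
  have : (S * (V K0 - eps) <= (1 - K k i) * (V K0 - eps))%R by rewrite ler_wpM2r//; lra.
  have : (p * (eps * (r ^+ k.+1 - 1)) <= K k i * (eps * (r ^+ k.+1 - 1)))%R.
    by rewrite ler_wpM2r// mulr_ge0 ?(ltW eps0)//; lra.
  lra.
have -> : (p * (eps * (r ^+ k.+1 - 1)) = eps * (2 * r ^+ k - p))%R.
  by rewrite exprS -pr; ring.
have : (eps * W k <= eps)%R by rewrite ler_piMr// ltW.
rewrite mulrBl mul1r {2}Wk.
have : (eps * p <= eps)%R by rewrite ler_piMr// ltW.
have : (eps <= eps * r ^+ k)%R by rewrite ler_peMr// ltW.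
lra.
Qed.

(** * One quenched step of a large population *)

(** For [M >= 1], the mean of the offspring number when every value that is at
    least [M] is replaced by [1].  It is a finite sum, and the replacement does
    not enlarge the probability of having no child. *)
Definition trunc_mean (R : realType) (p : probability nat R) (M : nat) : R :=
  (1 + \sum_(j < M) (j%:R - 1) * mass R p j)%R.

Lemma trunc_mean_ge (R : realType) (p : probability nat R) (M : nat) :
  (1 - mass R p 0%N <= trunc_mean R p M.+1)%R.
Proof.
rewrite /trunc_mean lerD2l big_ord_recl/= sub0r mulN1r lerDl.
apply: sumr_ge0 => j _; rewrite mulr_ge0 ?mass_ge0// subr_ge0.
by rewrite ler1n.
Qed.

Lemma trunc_mean_le (R : realType) (p : probability nat R) (M : nat) :
  (trunc_mean R p M.+1 <= M.+1%:R)%R.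
Proof.
rewrite -natr1 addrC lerD2l.
apply: le_trans (_ : _ <= \sum_(j < M.+1) M%:R * mass R p j)%R _.
  apply: ler_sum => j _; rewrite ler_wpM2r ?mass_ge0// lerBlDr natr1.
  by rewrite ler_nat ltnW// ltn_ord.
by rewrite -mulr_sumr -[leRHS]mulr1 ler_wpM2l// sum_mass_le1.
Qed.

Lemma expR_le_quadratic (R : realType) (x : R) :
  (x <= 2^-1 -> expR x <= 1 + x + 2 * x ^+ 2)%R.
Proof.
move=> x2; have x1 : (0 < 1 - x)%R by lra.
have h := expR_ge1Dx (- x)%R.
have e0 := expR_gt0 x.
have : (expR x * (1 - x) <= 1)%R.
  by rewrite -[leRHS]expR0 -(subrr x) expRD ler_wpM2l ?expR_ge0.
move=> h1.
have : (0 <= x ^+ 2 * (1 - 2 * x))%R by rewrite mulr_ge0 ?sqr_ge0//; lra.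
move=> h2; rewrite -(ler_pM2r x1) (le_trans h1)//.
have -> : ((1 + x + 2 * x ^+ 2) * (1 - x) = 1 + x ^+ 2 * (1 - 2 * x))%R by ring.
by rewrite lerDl.
Qed.

(** The replacement of large values by [1] can only increase [exp (- t * a)],
    and it makes the exponent at most [t * M.+1], so that the second-order
    expansion is uniform in the law. *)
Lemma laplace_offspring_le (R : realType) (p : probability nat R) (M J : nat) (t : R) :
  (0 <= t)%R ->
  (\sum_(a < J) mass R p a * expR (- t) ^+ a
    <= expR (- (t * trunc_mean R p M.+1) + 2 * t ^+ 2 * M.+1%:R ^+ 2))%R.
Proof.
move=> t0; set m := trunc_mean R p M.+1; set B := (2 * t ^+ 2 * M.+1%:R ^+ 2)%R.
have B0 : (0 <= B)%R by rewrite !mulr_ge0 ?sqr_ge0.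
have tB : (0 <= 1 - t + B)%R.
  have : (2 * t ^+ 2 <= B)%R.
    rewrite /B ler_peMr ?mulr_ge0 ?sqr_ge0//.
    by rewrite exprn_ege1// ler1n.
  have : (0 <= (t - 1) ^+ 2)%R by exact: sqr_ge0.
  have -> : ((t - 1) ^+ 2 = t ^+ 2 - 2 * t + 1)%R by ring.
  have := sqr_ge0 t; lra.
pose u (a : nat) : nat := if (a < M.+1)%N then a else 1%N.
have ua a : (u a <= a)%N.
  by rewrite /u; case: ifPn => //; rewrite -leqNgt; exact: leq_trans.
have uM a : (u a <= M.+1)%N by rewrite /u; case: ifPn => // /ltnW.
have expu a : (expR (- t) ^+ a <= 1 - t * (u a)%:R + B)%R.
  rewrite -expRM_natl; apply: le_trans (_ : _ <= expR (- (t * (u a)%:R)))%R _.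
    by rewrite ler_expR mulrN lerN2 mulrC ler_wpM2r// ler_nat.
  apply: le_trans (expR_le_quadratic _ _ _) _.
    by apply: (@le_trans _ _ 0%R); rewrite ?oppr_le0 ?mulr_ge0// invr_ge0.
  rewrite lerD2l sqrrN exprMn /B mulrA ler_wpM2l ?mulr_ge0 ?sqr_ge0//.
  by rewrite ler_sqr ?nnegrE// ler_nat.
have [J' [JJ' MJ']] : exists J', (J <= J')%N /\ (M.+1 <= J')%N.
  by exists (maxn J M.+1); rewrite leq_maxl leq_maxr.
apply: le_trans (_ : _ <= \sum_(a < J') mass R p a * (1 - t * (u a)%:R + B))%R _.
  rewrite (big_ord_widen J' (fun a => mass R p a * expR (- t) ^+ a)%R)// big_mkcond/=.
  apply: ler_sum => a _; case: ifP => _; first by rewrite ler_wpM2l ?mass_ge0.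
  by rewrite mulr_ge0 ?mass_ge0// (le_trans _ (expu a))// exprn_ge0// expR_ge0.
apply: le_trans (expR_ge1Dx _).
(* Values beyond the cut-off contribute like the value [1], for which the
   second sum has a vanishing term. *)
have -> : (\sum_(a < J') mass R p a * (1 - t * (u a)%:R + B) =
  (\sum_(a < J') mass R p a) * (1 - t + B) - t * \sum_(a < J') ((u a)%:R - 1) * mass R p a)%R.
  rewrite mulr_suml mulr_sumr -sumrB; apply: eq_bigr => a _; ring.
have -> : (\sum_(a < J') ((u a)%:R - 1) * mass R p a =
    \sum_(a < M.+1) (a%:R - 1) * mass R p a)%R.
  rewrite (big_ord_widen J' (fun a => (a%:R - 1) * mass R p a)%R)// [RHS]big_mkcond/=.
  by apply: eq_bigr => a _; rewrite /u; case: ifP => //; rewrite subrr mul0r.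
have : ((\sum_(a < J') mass R p a) * (1 - t + B) <= 1 * (1 - t + B))%R.
  by rewrite ler_wpM2r// sum_mass_le1.
rewrite /m /trunc_mean; set S := (\sum_(a < M.+1) _)%R.
by rewrite (_ : (t * (1 + S) = t + t * S)%R); [lra|ring].
Qed.

(** The power function [k ^ -alpha], with the value [1] at [0]. *)
Definition powN (R : realType) (alpha : R) (k : nat) : R :=
  expR (- (alpha * ln k%:R)).

Lemma powN01 (R : realType) (alpha : R) (k : nat) : (0 <= alpha)%R ->
  (0 < powN R alpha k <= 1)%R.
Proof.
move=> a0; rewrite expR_gt0/= -expR0 ler_expR oppr_le0 mulr_ge0//.
by case: k => [|k]; [rewrite ln0|rewrite ln_ge0// ler1n].
Qed.

Lemma powN_nonincreasing (R : realType) (alpha : R) (k l : nat) :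
  (0 <= alpha)%R -> (k <= l)%N -> (powN R alpha l <= powN R alpha k)%R.
Proof.
move=> a0; case: k => [|k] kl.
  by rewrite {2}/powN ln0// mulr0 oppr0 expR0; case/andP: (powN01 R alpha l a0).
rewrite ler_expR lerN2 ler_wpM2l// ler_ln ?posrE ?ltr0n ?(leq_trans _ kl)//.
by rewrite ler_nat.
Qed.

Lemma powN_decreasing (R : realType) (alpha : R) (k : nat) :
  (0 < alpha)%R -> (powN R alpha k.+2 < powN R alpha k.+1)%R.
Proof.
move=> a0; rewrite ltr_expR ltrN2 ltr_pM2l// ltr_ln ?posrE ?ltr0n//.
by rewrite ltr_nat.
Qed.

(** Chernoff's bound splits the mean of [powN] after one step according to
    whether at least a fraction [theta] of the expected number of children
    is born. *)
Lemma quenched_drift (R : realType) (q : Delta R) (alpha theta t b : R)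
    (M k J : nat) : (0 < k)%N -> (0 < alpha)%R -> (0 < theta < 1)%R ->
  (0 < b)%R -> (b <= trunc_mean R q.1 M.+1)%R ->
  t = ((1 - theta) * b / (4 * M.+1%:R ^+ 2))%R ->
  (\sum_(j < J) quenched R q k j * powN R alpha j <=
    powN R alpha k * expR (- (alpha * (ln theta + ln (trunc_mean R q.1 M.+1))))
    + expR (- (k%:R * (t * (1 - theta) * b / 2))))%R.
Proof.
move=> k0 a0 /andP[th0 th1] b0 bm tE; set m := trunc_mean R q.1 M.+1 in bm *.
have m0 : (0 < m)%R by exact: lt_le_trans bm.
have k0' : (0 < k%:R :> R)%R by rewrite ltr0n.
have M0 : (0 < 4 * M.+1%:R ^+ 2 :> R)%R by rewrite mulr_gt0// exprn_gt0.
have t0 : (0 < t)%R by rewrite tE divr_gt0// mulr_gt0// subr_gt0.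
(* Reaching [x] children makes [powN] small; the indicator of the complement
   is bounded by [exp (t * (x - j))]. *)
pose x := (theta * (k%:R * m))%R.
have x0 : (0 < x)%R by rewrite !mulr_gt0.
have V2 j : (powN R alpha j <= expR (- (alpha * ln x)) + expR (t * x) * expR (- t) ^+ j)%R.
  have e1 := expR_gt0 (- (alpha * ln x)).
  rewrite -expRM_natl -expRD.
  have [xj|jx] := leP x j%:R.
    rewrite -[leLHS]addr0 lerD ?expR_ge0// ler_expR lerN2 ler_pM2l//.
    by rewrite ler_ln// posrE// (lt_le_trans x0).
  have := powN01 R alpha j (ltW a0) => /andP[_] /le_trans; apply.
  rewrite -[leLHS]add0r lerD ?expR_ge0// -[leLHS]expR0 ler_expR.
  rewrite (_ : (t * x + j%:R * - t = t * (x - j%:R))%R); last by ring.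
  by rewrite mulr_ge0 ?(ltW t0)// subr_ge0 ltW.
apply: le_trans (_ : _ <= (\sum_(j < J) quenched R q k j) * expR (- (alpha * ln x)) +
   expR (t * x) * \sum_(j < J) quenched R q k j * expR (- t) ^+ j)%R _.
  rewrite mulr_suml mulr_sumr -big_split/=; apply: ler_sum => j _.
  rewrite mulrCA -mulrDr ler_wpM2l ?quenched_ge0//.
apply: lerD.
  apply: le_trans (_ : _ <= 1 * expR (- (alpha * ln x)))%R _.
    by rewrite ler_wpM2r ?expR_ge0// sum_quenched_le1.
  rewrite mul1r /powN -expRD /x !lnM ?posrE ?mulr_gt0//.
  by rewrite ler_expR; lra.
apply: le_trans (_ : _ <= expR (t * x) *
   expR (- (t * m) + 2 * t ^+ 2 * M.+1%:R ^+ 2) ^+ k)%R _.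
  rewrite ler_wpM2l ?expR_ge0//.
  apply: le_trans (sum_quenched_exp_le R q (expR (- t)) k J _) _.
    by rewrite expR_ge0/= -expR0 ler_expR oppr_le0 ltW.
  rewrite lerXn2r ?nnegrE ?expR_ge0//; last exact: laplace_offspring_le (ltW t0).
  by apply: sumr_ge0 => a _; rewrite mulr_ge0 ?mass_ge0// exprn_ge0// expR_ge0.
rewrite -expRM_natl -expRD ler_expR /x.
have -> : (t * (theta * (k%:R * m)) + k%:R * (- (t * m) + 2 * t ^+ 2 * M.+1%:R ^+ 2)
   = k%:R * (2 * t ^+ 2 * M.+1%:R ^+ 2 - t * ((1 - theta) * m)))%R by ring.
rewrite -[leRHS]mulrN ler_pM2l//.
have tE' : (2 * t ^+ 2 * M.+1%:R ^+ 2 = t * ((1 - theta) * b / 2))%R.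
  have : (M.+1%:R != 0 :> R)%R by rewrite pnatr_eq0.
  rewrite expr2 {2}tE; move: (M.+1%:R : R)%R => y y0; field.
  by rewrite y0.
rewrite tE'.
have : (t * ((1 - theta) * b) <= t * ((1 - theta) * m))%R.
  by rewrite ler_pM2l// ler_pM2l// subr_gt0.
lra.
Qed.

(** * Averaging over the environment *)

Lemma cvg_sum_mass (R : realType) (p : probability nat R) :
  (\sum_(j < n) mass R p j)%R @[n --> \oo] --> (1 : R)%R.
Proof.
have [_] : (\forall n \near \oo, (\sum_(0 <= j < n) p [set j]) \is a fin_num) /\
    (fine \o (fun n => \sum_(0 <= j < n) p [set j])) n @[n --> \oo] --> (1 : R)%R.
  apply/fine_cvgP.
  have -> : 1%:E = \sum_(0 <= j <oo) p [set j].
    transitivity (p setT); first by rewrite probability_setT.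
    etransitivity; first exact: (@measure_fibers _ _ _ p id setT).
    by apply: eq_eseriesr => j _; rewrite setTI.
  exact: is_cvg_nneseries.
apply: cvg_trans; apply: near_eq_cvg; apply: nearW => n /=.
rewrite big_mkord -sum_fine// => j _.
by rewrite fin_num_measure.
Qed.

(** Above the threshold [1] the cut-off only removes mass from the mean. *)
Lemma cvg_trunc_mean (R : realType) (p : probability nat R) :
  law_mean p < +oo ->
  trunc_mean R p n.+1 @[n --> \oo] --> fine (law_mean p) /\
  forall n, (trunc_mean R p n.+1 <= fine (law_mean p))%R.
Proof.
move=> mfin.
have term0 j : 0 <= j%:R%:E * p [set j] by rewrite mule_ge0// lee_fin.
have m0 : 0 <= law_mean p by apply: nneseries_ge0 => j _ _; exact: term0.
have mfin' : law_mean p \is a fin_num by rewrite ge0_fin_numE.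
have cvgm : (\sum_(j < n) j%:R * mass R p j)%R @[n --> \oo] --> fine (law_mean p).
  have [_] : (\forall n \near \oo, (\sum_(0 <= j < n) j%:R%:E * p [set j]) \is a fin_num) /\
      (fine \o (fun n => \sum_(0 <= j < n) j%:R%:E * p [set j])) n @[n --> \oo]
       --> fine (law_mean p).
    apply/fine_cvgP; rewrite fineK//.
    by apply: is_cvg_nneseries => j _ _; exact: term0.
  apply: cvg_trans; apply: near_eq_cvg; apply: nearW => n /=.
  rewrite big_mkord -sum_fine//; last by move=> j _; rewrite fin_numM// fin_num_measure.
  by apply: eq_bigr => j _; rewrite fineM// fin_num_measure.
have cvgt : trunc_mean R p n.+1 @[n --> \oo] --> fine (law_mean p).
  have -> : (fun n => trunc_mean R p n.+1) = (fun n =>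
      1 + (\sum_(j < n.+1) j%:R * mass R p j - \sum_(j < n.+1) mass R p j))%R.
    apply/funext => n; rewrite /trunc_mean -sumrB; congr (_ + _)%R.
    by apply: eq_bigr => j _; rewrite mulrBl mul1r.
  rewrite [X in _ --> X](_ : _ = 1 + (fine (law_mean p) - 1))%R; last by ring.
  apply: cvgD; first exact: cvg_cst.
  apply: cvgB.
    by rewrite (cvg_shiftS (fun n => \sum_(j < n) j%:R * mass R p j)%R).
  by rewrite (cvg_shiftS (fun n => \sum_(j < n) mass R p j)%R); exact: cvg_sum_mass.
split=> // n; rewrite -(cvg_lim (@Rhausdorff R) cvgt).
apply: (@nondecreasing_cvgn_le _ (fun n => trunc_mean R p n.+1)); last first.
  by apply/cvg_ex; eexists; exact: cvgt.
apply/nondecreasing_seqP => i; rewrite /trunc_mean lerD2l [leRHS]big_ord_recr/= lerDl.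
by rewrite mulr_ge0 ?mass_ge0// subr_ge0 ler1n.
Qed.

Lemma measurable_trunc_mean (R : realType) (M : nat) :
  measurable_fun [set: EnvSpace R] (fun q : EnvSpace R => trunc_mean R q.1 M).
Proof.
apply: measurable_funD; first exact: measurable_cst.
apply: measurable_sum => j; apply: measurable_funM; first exact: measurable_cst.
exact: measurable_offspring.
Qed.

(** The maximum with [b], which is the truncated mean itself almost surely,
    makes the function bounded everywhere. *)
Definition log_trunc_mean (R : realType) (b : R) (M : nat) (q : Delta R) : R :=
  ln (Num.max b (trunc_mean R q.1 M.+1)).

Section environment_average.
Context (R : realType) (d : measure_display) (T : measurableType d)
  (P : probability T R) (X : T -> Delta R) (b : R).
Hypothesis mX : measurable_fun setT (X : T -> EnvSpace R).
Hypothesis b01 : (0 < b < 1)%R.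
Hypothesis surv : {ae P, forall w, (X w).1 [set 0%N] < (1 - b)%:E}.

Let ae_mean : {ae P, forall w, forall M, (b <= trunc_mean R (X w).1 M.+1)%R}.
Proof.
apply: filterS surv => w Hw M; apply: le_trans (trunc_mean_ge R _ M).
have : (mass R (X w).1 0%N < 1 - b)%R by rewrite -lte_fin fineK// fin_num_measure.
lra.
Qed.

Notation logm M w := (log_trunc_mean R b M (X w)).

Let mlogm M : measurable_fun setT (fun w => logm M w).
Proof.
apply: (measurableT_comp (@measurable_ln R)).
apply: measurable_maxr; first exact: measurable_cst.
exact: (measurableT_comp (measurable_trunc_mean R M.+1) mX).
Qed.

(** By dominated convergence: the truncated means increase to the mean, and
    their logarithms stay above [ln b]. *)
Lemma trunc_log_mean_pos :
  {ae P, forall w, 0 < law_mean (X w).1 < +oo} ->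
  P.-integrable setT (fun w => lne (law_mean (X w).1)) ->
  0 < \int[P]_w lne (law_mean (X w).1) ->
  exists M, 0 < \int[P]_w (logm M w)%:E.
Proof.
move=> hm hint hpos.
have /andP[b0 b1] := b01.
have bmax (y : R) : (0 < Num.max b y)%R by rewrite lt_max b0.
have cvgf : {ae P, forall w, setT w ->
    (logm M w)%:E @[M --> \oo] --> lne (law_mean (X w).1)}.
  apply: filterS2 hm ae_mean => w /andP[m0 moo] bm _.
  have [cvgm lem] := cvg_trunc_mean R _ moo.
  have mfin : law_mean (X w).1 \is a fin_num by rewrite ge0_fin_numE ?ltW.
  have mE : law_mean (X w).1 = (fine (law_mean (X w).1))%:E by rewrite fineK.
  rewrite mE in m0 *; move: (fine _) cvgm m0 {lem mE} => m cvgm; rewrite lte_fin => m0.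
  rewrite lne_EFin//; apply: cvg_EFin; first exact: nearW.
  rewrite (_ : fine \o _ = fun M => ln (trunc_mean R (X w).1 M.+1)); last first.
    by apply/funext => M; rewrite /= /log_trunc_mean max_r.
  exact: (continuous_cvg _ (continuous_ln m0)).
have dom : {ae P, forall w M, setT w ->
    `|(logm M w)%:E| <= `|lne (law_mean (X w).1)| + `|ln b|%:E}.
  apply: filterS hm => w /andP[m0 moo] M _.
  have [cvgm lem] := cvg_trunc_mean R _ moo.
  have mfin : law_mean (X w).1 \is a fin_num by rewrite ge0_fin_numE ?ltW.
  have mE : law_mean (X w).1 = (fine (law_mean (X w).1))%:E by rewrite fineK.
  rewrite mE in m0 *; move: (fine _) m0 lem {cvgm mE} => m; rewrite lte_fin => m0 lem.
  rewrite lne_EFin// !abse_EFin -EFinD lee_fin /log_trunc_mean.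
  have lnb : (ln b < 0)%R by rewrite ln_lt0// b0.
  have [mb|bm] := leP (trunc_mean R (X w).1 M.+1) b.
    by rewrite lerDr.
  have mu0 := lt_trans b0 bm.
  have : (ln (trunc_mean R (X w).1 M.+1) <= ln m)%R by rewrite ler_ln ?posrE// lem.
  have : (ln b <= ln (trunc_mean R (X w).1 M.+1))%R by rewrite ler_ln ?posrE// ltW.
  have := ler_norm (ln m); have := normr_ge0 (ln m).
  rewrite ler_norml (ltr0_norm lnb); lra.
have dint : P.-integrable setT (fun w => `|lne (law_mean (X w).1)| + `|ln b|%:E).
  apply: integrableD => //; first exact: integrable_abse.
  exact: finite_measure_integrable_cst.
have [_ _ cvgI] := @dominated_convergence _ T R P setT measurableT
  (fun M w => (logm M w)%:E) (fun w => lne (law_mean (X w).1)) _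
  (fun M => (measurable_EFinP _ _).2 (mlogm M))
  (measurable_int _ hint) cvgf dint dom.
have [M _ HM] := cvgI _ (open_nbhs_nbhs (conj (open_ereal_gt_ereal (x := 0)) hpos)).
by exists M; exact: HM (leqnn M).
Qed.

Let annealed_fin k j : annealed R d T P X k j \is a fin_num.
Proof.
apply: integral01_fin_num => [|w]; last exact: quenched01.
exact: (measurableT_comp (measurable_quenched R k j) mX).
Qed.

Lemma annealed_sum (V : nat -> R) (k J : nat) : (forall j, 0 <= V j)%R ->
  (\sum_(j < J) fine (annealed R d T P X k j) * V j)%:E =
  \int[P]_w (\sum_(j < J) quenched R (X w) k j * V j)%:E.
Proof.
move=> V0; have mq j : measurable_fun setT (fun w => quenched R (X w) k j).
  exact: (measurableT_comp (measurable_quenched R k j) mX).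
rewrite -sumEFin; under eq_integral do rewrite -sumEFin.
rewrite (@ge0_integral_sum _ _ _ P setT measurableT _
  (fun (j : 'I_J) w => (quenched R (X w) k j * V j)%:E)) //; last 2 first.
- move=> j; apply/measurable_EFinP.
  by apply: measurable_funM => //; exact: mq.
- by move=> j w _; rewrite lee_fin mulr_ge0// quenched_ge0.
apply: eq_bigr => j _; rewrite EFinM fineK// muleC.
under eq_integral do rewrite mulrC EFinM.
rewrite ge0_integralZl//; first exact/measurable_EFinP.
- by move=> w _; rewrite lee_fin quenched_ge0.
- by rewrite lee_fin.
Qed.

Let logm_bound M w : (`|logm M w| <= `|ln b| + ln M.+1%:R)%R.
Proof.
have /andP[b0 b1] := b01.
have lnb : (ln b < 0)%R by rewrite ln_lt0// b0.
have lnM : (0 <= ln M.+1%:R :> R)%R by rewrite ln_ge0// ler1n.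
have bM : (b <= M.+1%:R)%R by rewrite (le_trans (ltW b1))// ler1n.
have max0 : (0 < Num.max b (trunc_mean R (X w).1 M.+1))%R by rewrite lt_max b0.
have : (ln b <= logm M w)%R by rewrite /log_trunc_mean ler_ln ?posrE// le_max lexx.
have : (logm M w <= ln M.+1%:R)%R.
  by rewrite /log_trunc_mean ler_ln ?posrE ?ltr0n// ge_max bM trunc_mean_le.
by rewrite ler_norml (ltr0_norm lnb); lra.
Qed.

(** A small negative power of the population size contracts from one large
    generation to the next: [E (m ^ -alpha)] is [1 - alpha * E (ln m)] to first
    order, and Chernoff's error term is exponentially small in the size. *)
Lemma annealed_drift M : 0 < \int[P]_w (logm M w)%:E ->
  exists (alpha gamma : R) (K0 : nat), [/\ (0 < alpha)%R, (0 <= gamma < 1)%R &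
  forall k J, (K0 < k)%N ->
    (\sum_(j < J) fine (annealed R d T P X k j) * powN R alpha j
      <= gamma * powN R alpha k)%R].
Proof.
move=> Epos; have /andP[b0 b1] := b01.
pose L := (`|ln b| + ln M.+1%:R)%R.
have intlog : P.-integrable setT (EFin \o (fun w => logm M w)).
  apply: measurable_bounded_integrable => //.
    by rewrite (le_lt_trans (probability_le1 _ _)) ?ltry.
  exists L; split; first exact: num_real.
  move=> y Ly w _; exact: le_trans (logm_bound M w) (ltW Ly).
have Efin := integrable_fin_num measurableT intlog.
pose E0 := fine (\int[P]_w (logm M w)%:E).
have E0E : \int[P]_w (logm M w)%:E = E0%:E by rewrite fineK.
have E0pos : (0 < E0)%R by rewrite -lte_fin -E0E.
have L0 : (0 <= L)%R by apply: le_trans (logm_bound M point).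
pose B := (L + E0 + 1)%R.
have B1 : (1 <= B)%R by rewrite /B; lra.
have B0 : (0 < B)%R by lra.
(* With this [alpha] the quadratic error [2 * alpha ^ 2 * B ^ 2] is half of the
   first-order gain [alpha * E0 / 2]. *)
pose alpha := (E0 / (8 * B ^+ 2))%R.
have BB0 : (0 < 8 * B ^+ 2)%R by rewrite mulr_gt0// exprn_gt0.
have alpha0 : (0 < alpha)%R by rewrite divr_gt0.
have aB2 : (2 * alpha ^+ 2 * B ^+ 2 = alpha * E0 / 4)%R.
  by rewrite /alpha; field; rewrite gt_eqF.
have aB : (alpha * B <= 8^-1)%R.
  rewrite (_ : alpha * B = 8^-1 * (E0 / B))%R; last by rewrite /alpha; field; rewrite gt_eqF.
  rewrite -[leRHS]mulr1 ler_wpM2l// ?invr_ge0// ler_pdivrMr// mul1r /B; lra.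
have alpha1 : (alpha <= 8^-1)%R by rewrite (le_trans _ aB)// ler_pMr.
have aE0 : (alpha * E0 <= 8^-1)%R by rewrite (le_trans _ aB)// ler_pM2l// /B; lra.
have aE0p : (0 < alpha * E0)%R by rewrite mulr_gt0.
(* The loss [theta] takes away half of the mean logarithmic growth [E0]. *)
pose theta := expR (- (E0 / 2)).
have theta0 : (0 < theta)%R by exact: expR_gt0.
have theta1 : (theta < 1)%R by rewrite -expR0 ltr_expR; lra.
pose t := ((1 - theta) * b / (4 * M.+1%:R ^+ 2))%R.
have t0 : (0 < t)%R.
  by rewrite divr_gt0// mulr_gt0// ?subr_gt0// exprn_gt0// ltr0n.
pose c := (t * (1 - theta) * b / 2)%R.
have c0 : (0 < c)%R by rewrite !mulr_gt0// ?subr_gt0// invr_gt0.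
(* For [k >= A] Chernoff's error [exp (- k * c) <= 4 / (k * c) ^ 2] is at most
   [alpha * E0 / (8 * k)], and [1 / k <= k ^ -alpha]. *)
pose A := (32 / (c ^+ 2 * (alpha * E0)))%R.
have A0 : (0 <= A)%R by rewrite ltW// divr_gt0// mulr_gt0// exprn_gt0.
exists alpha, (1 - alpha * E0 / 8)%R, (Num.bound A); split => //; first lra.
move=> k J Kk.
have Ak : (A <= k%:R)%R.
  by rewrite (le_trans (ltW (archi_boundP A0)))// ler_nat ltnW.
have k0 : (0 < k)%N by rewrite (leq_ltn_trans _ Kk).
have k0' : (0 < k%:R :> R)%R by rewrite ltr0n.
set v := powN R alpha k.
have v0 : (0 < v)%R by exact: expR_gt0.
have vk : (k%:R^-1 <= v)%R.
  rewrite -[leLHS]lnK ?posrE ?invr_gt0// ler_expR lnV ?posrE// lerN2.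
  have : (0 <= ln k%:R :> R)%R by rewrite ln_ge0// ler1n.
  move=> l0; rewrite ler_piMl//; lra.
have chernoff : (expR (- (k%:R * c)) <= v * (alpha * E0 / 8))%R.
  have ekc : ((k%:R * c / 2) ^+ 2 <= expR (k%:R * c))%R.
    have kc0 : (0 <= k%:R * c / 2)%R by rewrite divr_ge0// mulr_ge0// ltW.
    rewrite [X in expR X](_ : _ = 2%:R * (k%:R * c / 2))%R; last by field.
    rewrite expRM_natl lerXn2r ?nnegrE ?expR_ge0//.
    have := expR_ge1Dx (k%:R * c / 2)%R; lra.
  apply: le_trans (_ : _ <= k%:R^-1 * (alpha * E0 / 8))%R _; last first.
    by rewrite ler_wpM2r// divr_ge0// ltW.
  rewrite expRN -[leLHS]mul1r ler_pdivrMr ?expR_gt0//.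
  apply: le_trans (_ : _ <= k%:R^-1 * (alpha * E0 / 8) * (k%:R * c / 2) ^+ 2)%R _; last first.
    by rewrite ler_wpM2l// mulr_ge0 ?invr_ge0 ?(ltW k0')// divr_ge0// ltW.
  rewrite [leRHS](_ : _ = k%:R * (c ^+ 2 * (alpha * E0)) / 32)%R; last first.
    by field; rewrite gt_eqF.
  rewrite ler_pdivlMr// mul1r -ler_pdivrMr//.
  by rewrite mulr_gt0// exprn_gt0.
have logB w : (`|- (E0 / 2) + logm M w| <= B)%R.
  have := logm_bound M w; rewrite -/L !ler_norml /B; lra.
have absB w : (`|alpha * (- (E0 / 2) + logm M w)| <= 8^-1)%R.
  by rewrite normrM gtr0_norm// (le_trans _ aB)// ler_pM2l.
pose F w := (v * (1 + alpha * E0 / 2 + alpha * E0 / 4)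
   + expR (- (k%:R * c)) + (- (v * alpha)) * logm M w)%R.
have pw : {ae P, forall w, setT w ->
    (\sum_(j < J) quenched R (X w) k j * powN R alpha j)%:E <= (F w)%:E}.
  apply: filterS ae_mean => w bm _; rewrite lee_fin.
  have th01 : (0 < theta < 1)%R by rewrite theta0 theta1.
  have := @quenched_drift R (X w) alpha theta t b M k J k0 alpha0 th01 b0 (bm M) erefl.
  move=> /le_trans; apply.
  rewrite -/v -/c /theta expRK /F.
  have -> : ln (trunc_mean R (X w).1 M.+1) = logm M w by rewrite /log_trunc_mean max_r.
  have := absB w; set y := (alpha * _)%R; rewrite ler_norml => /andP[y1 y2].
  have := @expR_le_quadratic R (- y)%R; rewrite sqrrN => /(_ ltac:(lra)) ey.
  have yy : (2 * y ^+ 2 <= alpha * E0 / 4)%R.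
    have a20 : (0 <= 2 * alpha ^+ 2)%R by rewrite mulr_ge0// sqr_ge0.
    rewrite -aB2 /y exprMn mulrA ler_wpM2l//.
    by rewrite -real_normK ?num_real// ler_sqr ?nnegrE// ltW.
  have : (v * expR (- y) <= v * (1 + alpha * E0 / 2 + alpha * E0 / 4 - alpha * logm M w))%R.
    rewrite ler_pM2l// (le_trans ey)//; rewrite /y in yy *; lra.
  lra.
have F0 w : (0 <= F w)%R.
  have := absB w; rewrite ler_norml => /andP[_ yB].
  have : (0 <= v * (1 + alpha * E0 / 2 + alpha * E0 / 4 - alpha * logm M w))%R.
    by rewrite mulr_ge0 ?(ltW v0)//; lra.
  have := expR_gt0 (- (k%:R * c))%R; rewrite /F; lra.
have mF : measurable_fun setT F.
  by apply: measurable_funD => //; apply: measurable_funM.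
rewrite -lee_fin annealed_sum; last by move=> j; exact: expR_ge0.
apply: le_trans (ae_ge0_le_integral measurableT _ _ _ _ pw) _.
- move=> w _; rewrite lee_fin; apply: sumr_ge0 => j _.
  by rewrite mulr_ge0 ?quenched_ge0// expR_ge0.
- apply/measurable_EFinP; apply: measurable_sum => j; apply: measurable_funM => //.
  exact: (measurableT_comp (measurable_quenched R k j) mX).
- by move=> w _; rewrite lee_fin.
- exact/measurable_EFinP.
rewrite /F; under eq_integral do rewrite EFinD EFinM.
rewrite integralD//; last 2 first.
- exact: finite_measure_integrable_cst.
- exact: integrableZl.
rewrite integralZl// E0E integral_cst//.
rewrite [X in _ * X + _](_ : _ = 1); last exact: probability_setT.
rewrite mule1 -EFinM -EFinD lee_fin; lra.
Qed.
End environment_average.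

(** * Reachability *)

Lemma mass0_eq1 (R : realType) (p : probability nat R) :
  (forall y, mass R p y.+1 = 0)%R -> mass R p 0%N = 1%R.
Proof.
move=> p0; have := cvg_sum_mass R p; rewrite -cvg_shiftS.
rewrite (_ : (fun n => _) = fun=> mass R p 0%N); last first.
  by apply/funext => n; rewrite big_ord_recl/= big1 ?addr0.
by move=> /(cvg_lim (@Rhausdorff R)) <-; rewrite lim_cst.
Qed.

Lemma exists_mass_gt0 (R : realType) (p : probability nat R) :
  exists y, (0 < mass R p y)%R.
Proof.
apply: contrapT => none.
have p0 y : mass R p y = 0%R.
  apply/eqP; rewrite eq_le mass_ge0 andbT leNgt; apply/negP => py.
  by apply: none; exists y.
have := mass0_eq1 R p (fun y => p0 y.+1).
by rewrite p0 => /esym/eqP; rewrite oner_eq0.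
Qed.

Lemma annealed_ge (R : realType) (d : measure_display)
    (T : measurableType d) (P : probability T R) (X : T -> Delta R) (A : set T)
    (e : R) (k j : nat) :
  measurable_fun setT (X : T -> EnvSpace R) -> measurable A -> (0 <= e)%R ->
  (forall w, A w -> (e <= quenched R (X w) k j)%R) ->
  e%:E * P A <= annealed R d T P X k j.
Proof.
move=> mX mA e0 qA.
have mq : measurable_fun setT (fun w => (quenched R (X w) k j)%:E).
  by apply/measurable_EFinP; exact: (measurableT_comp (measurable_quenched R k j) mX).
rewrite -(integral_cst P mA).
apply: le_trans (_ : _ <= \int[P]_(w in A) (quenched R (X w) k j)%:E) _.
  by apply: ge0_le_integral => //; exact: measurable_funTS.
apply: ge0_subset_integral => //.
by move=> w _; rewrite lee_fin quenched_ge0.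
Qed.

Lemma annealed_gt0 (R : realType) (d : measure_display)
    (T : measurableType d) (P : probability T R) (X : T -> Delta R) (k j : nat)
    (g : T -> R) :
  measurable_fun setT (X : T -> EnvSpace R) -> measurable_fun setT g ->
  (forall w, g w <= quenched R (X w) k j)%R ->
  0 < P [set w | (0 < g w)%R] -> 0 < annealed R d T P X k j.
Proof.
move=> mX mg gq Pg; have [e e0 Pe] := pos_superlevel _ _ _ P _ mg Pg.
have mA : measurable [set w | (e <= g w)%R] by exact: measurable_superlevel.
apply: lt_le_trans (annealed_ge R d T P X _ e k j mX mA (ltW e0) _).
  by rewrite mule_gt0.
by move=> w /= ew; exact: le_trans (gq w).
Qed.

Section reachability.
Context (R : realType) (d : measure_display) (T : measurableType d)
  (P : probability T R) (X : T -> Delta R).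
Hypothesis mX : measurable_fun setT (X : T -> EnvSpace R).

Let m1 j : measurable_fun setT (fun w => mass R (X w).1 j).
Proof. exact: (measurableT_comp (measurable_offspring R [set j]) mX). Qed.

Let m2 j : measurable_fun setT (fun w => mass R (X w).2 j).
Proof. exact: (measurableT_comp (measurable_immigration R [set j]) mX). Qed.

(** Environments that let every individual have [0] or [1] child and bring no
    immigrant lead from [l] to any population that is not larger; the price
    is exponential in [l]. *)
Lemma annealed_down :
  0 < P [set w | (0 < Num.min (mass R (X w).2 0%N)
                   (Num.min (mass R (X w).1 0%N) (mass R (X w).1 1%N)))%R] ->
  exists2 e : R, (0 < e <= 1)%R & forall l j, (j <= l)%N ->
    (e ^+ l.+2)%:E <= annealed R d T P X l j.
Proof.
move=> Pg; pose g w := Num.min (mass R (X w).2 0%N)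
  (Num.min (mass R (X w).1 0%N) (mass R (X w).1 1%N)).
have mg : measurable_fun setT g.
  by apply: measurable_minr => //; apply: measurable_minr.
have [e e0 Pe] := pos_superlevel _ _ _ P g mg Pg.
set A := [set w | _] in Pe.
have mA : measurable A by exact: measurable_superlevel.
have PA1 : P A <= 1 by exact: probability_le1.
have PAfin : P A \is a fin_num by rewrite fin_num_measure.
pose e' := Num.min 1%R (Num.min e (fine (P A))).
have pA0 : (0 < fine (P A))%R by rewrite fine_gt0// Pe (le_lt_trans PA1) ?ltry.
have e'0 : (0 < e')%R by rewrite !lt_min ltr01 e0 pA0.
have e'1 : (e' <= 1)%R by rewrite ge_min lexx.
have e'e : (e' <= e)%R by rewrite !ge_min lexx !orbT.
have e'A : (e' <= fine (P A))%R by rewrite !ge_min lexx !orbT.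
exists e'; first by rewrite e'0 e'1.
move=> l j jl.
apply: le_trans (annealed_ge R d T P X A (e' ^+ l.+1) l j mX mA _ _).
- rewrite -(fineK PAfin) -EFinM lee_fin exprSr ler_wpM2l// exprn_ge0//; exact: ltW.
- by rewrite exprn_ge0// ltW.
move=> w; rewrite /A /g /= !le_min => /and3P[h0 f0 f1].
have := quenched_ge R (X w) (fun i => (i < j)%N) l 0.
rewrite addn0 (_ : \sum_(i < l) (i < j)%N = j)%N; last first.
  rewrite -(big_mkord xpredT (fun i => (i < j)%N : nat)).
  rewrite (big_cat_nat (leq0n j) jl)/= -[RHS]addn0; congr (_ + _)%N.
    rewrite -[RHS]subn0 -[RHS]muln1 -sum_nat_const_nat.
    by rewrite big_nat [RHS]big_nat; apply: eq_bigr => i /andP[_ ->].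
  by rewrite big_nat big1// => i /andP[ji _]; rewrite ltnNge ji.
apply: le_trans; rewrite exprS.
have e'ge0 := ltW e'0.
apply: ler_pM => //; rewrite ?exprn_ge0//; first exact: le_trans h0.
rewrite -[in leLHS](card_ord l) -prodr_const; apply: ler_prod => i _.
rewrite e'ge0/=; case: (i < j)%N; first exact: le_trans f1.
exact: le_trans f0.
Qed.

Hypothesis hm : {ae P, forall w, 0 < law_mean (X w).1 < +oo}.
Hypothesis hlog : P.-integrable setT (fun w => lne (law_mean (X w).1)).
Hypothesis hsuper : 0 < \int[P]_w lne (law_mean (X w).1).

Let law_mean_le1 (p : probability nat R) :
  (forall j, (2 <= j)%N -> mass R p j = 0%R) -> law_mean p <= 1.
Proof.
move=> p0; apply: lime_le.
  by apply: is_cvg_nneseries => j _ _; rewrite mule_ge0// lee_fin.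
apply: nearW => n; apply: le_trans (_ : _ <= \sum_(0 <= j < n) (mass R p j)%:E) _.
  apply: lee_sum => -[|[|j]] _; rewrite ?mul0e ?lee_fin ?mass_ge0//.
    by rewrite mul1e fineK ?fin_num_measure.
  rewrite -[p [set j.+2]]fineK ?fin_num_measure// -/(mass R p j.+2) p0//.
  by rewrite mule0.
by rewrite big_mkord sumEFin lee_fin sum_mass_le1.
Qed.

(** A process that could never grow would have offspring means at most [1]. *)
Lemma annealed_up k : (0 < k)%N ->
  exists2 i, (k < i)%N & 0 < annealed R d T P X k i.
Proof.
move=> k0; apply: contrapT => none.
have null j y : P.-negligible [set w |
    (0 < mass R (X w).2 y * mass R (X w).1 j.+2 ^+ k)%R].
  apply/negligibleP.
    apply: measurable_strict_superlevel; apply: measurable_funM => //.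
    exact: measurable_funX.
  apply/eqP; rewrite eq_le measure_ge0 andbT leNgt; apply/negP => Pjy.
  apply: none; exists (k * j.+2 + y)%N.
    by rewrite (leq_trans (ltn_Pmulr (isT : (1 < j.+2)%N) k0))// leq_addr.
  apply: (annealed_gt0 R d T P X _ _ _ mX _ _ Pjy).
    by apply: measurable_funM => //; exact: measurable_funX.
  move=> w; have := quenched_ge R (X w) (fun=> j.+2) k y.
  by rewrite sum_nat_const card_ord prodr_const card_ord.
have le1 : {ae P, forall w, law_mean (X w).1 <= 1}.
  have : {ae P, forall w j y, (mass R (X w).2 y * mass R (X w).1 j.+2 ^+ k <= 0)%R}.
    apply: ae_foralln => j; apply: ae_foralln => y.
    by apply: negligibleS (null j y) => w /= /negP; rewrite -ltNge.
  apply: filterS => w Hw; apply: law_mean_le1 => -[|[|j]]// _.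
  have [y y0] := exists_mass_gt0 R (X w).2.
  apply/eqP; rewrite eq_le mass_ge0 andbT leNgt; apply/negP => j0.
  by have := Hw j y; rewrite leNgt mulr_gt0// exprn_gt0.
move: hsuper; rewrite integralE.
rewrite (_ : \int[P]_x _ ^\+ x = 0); last first.
  rewrite -[RHS](@integral0 _ _ _ P setT); apply: ge0_ae_eq_integral => //.
    by apply: measurable_funepos; exact: measurable_int hlog.
  apply: filterS le1 => w mle1 _.
  by rewrite (@le0_funeposE _ _ [set w]) ?inE// => _ ->; rewrite lne_le0.
rewrite sub0e oppe_gt0 ltNge => /negP; apply.
by apply: integral_ge0 => w _; exact: funeneg_ge0.
Qed.

(** Only immigration leads out of the empty population. *)
Lemma annealed_up0 : 0 < P [set w | (mass R (X w).2 0%N < 1)%R] ->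
  exists2 i, (0 < i)%N & 0 < annealed R d T P X 0 i.
Proof.
move=> P1; apply: contrapT => none.
have null y : P.-negligible [set w | (0 < mass R (X w).2 y.+1)%R].
  apply/negligibleP; first exact: measurable_strict_superlevel.
  apply/eqP; rewrite eq_le measure_ge0 andbT leNgt; apply/negP => Py.
  by apply: none; exists y.+1 => //; exact: (annealed_gt0 R d T P X _ _ _ mX (m2 y.+1) _ Py).
have ae0 : {ae P, forall w y, (mass R (X w).2 y.+1 <= 0)%R}.
  apply: ae_foralln => y.
  by apply: negligibleS (null y) => w /= /negP; rewrite -ltNge.
have : P.-negligible [set w | (mass R (X w).2 0%N < 1)%R].
  apply: negligibleS ae0 => w /= w1 Hw; move: w1.
  rewrite mass0_eq1 ?ltxx// => y.
  by apply/eqP; rewrite eq_le Hw mass_ge0.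
move/negligibleP => P0; move: P1; rewrite P0 ?ltxx//.
rewrite (_ : [set _ | _] = (fun w => mass R (X w).2 0%N) @^-1` `]-oo, 1%R[%classic).
  by apply: measurable_preimage => //; exact: m2.
by apply/seteqP; split => w /=; rewrite in_itv.
Qed.
End reachability.

(** * Exponential rates *)

(** Fekete's lemma. *)
Lemma superadditive_cvg (R : realType) (a : nat -> R) (C : R) :
  (a 0%N = 0)%R -> (forall n m, a n + a m <= a (n + m)%N)%R ->
  (forall n, a n <= C * n%:R)%R ->
  exists2 rho : R, (rho <= C)%R &
    (n%:R^-1 * a n)%R @[n --> \oo] --> rho.
Proof.
move=> a0 asup aC.
pose S := [set (n.+1%:R^-1 * a n.+1)%R | n in [set: nat]].
have ubS : ubound S C.
  by move=> _ [n _ <-]; rewrite mulrC ler_pdivrMr ?ltr0n// aC.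
have supS : has_sup S by split; [exists (1%:R^-1 * a 1%N)%R, 0%N|exists C].
exists (sup S); first by apply: ge_sup => //; case: supS.
have amul q m : (q%:R * a m <= a (q * m)%N)%R.
  elim: q => [|q IH]; first by rewrite mul0r mul0n a0.
  by rewrite mulSn -natr1 mulrDl mul1r addrC (le_trans _ (asup _ _))// lerD2l.
apply/cvgrPdist_lt => e e0.
have e20 : (0 < e / 2)%R by rewrite divr_gt0.
have [_ [m' _ <-] Hm] := sup_adherent e20 supS.
set m := m'.+1 in Hm; set l := (sup S - e / 2)%R in Hm.
have m0 : (0 < m%:R :> R)%R by rewrite ltr0n.
have lm : (m%:R * l <= a m)%R by rewrite -ler_pdivlMl// ltW.
pose D := (m%:R * `|a 1%N - l|)%R.
have D0 : (0 <= D)%R by rewrite mulr_ge0.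
have aD n : (n%:R * l - D <= a n)%R.
  rewrite (divn_eq n m); set q := (n %/ m)%N; set r := (n %% m)%N.
  have rm : (r%:R <= m%:R :> R)%R by rewrite ler_nat ltnW// ltn_mod.
  have h1 := amul q m; have h2 := amul r 1%N; rewrite muln1 in h2.
  have h3 := asup (q * m)%N r.
  have h4 : (q%:R * (m%:R * l) <= q%:R * a m)%R by rewrite ler_wpM2l.
  have h5 : (r%:R * (l - a 1%N) <= D)%R.
    apply: le_trans (_ : _ <= r%:R * `|a 1%N - l|)%R _; last by rewrite ler_wpM2r.
    by rewrite ler_wpM2l// distrC ler_norm.
  rewrite natrD natrM; lra.
pose N := Num.bound (D / (e / 2)).
exists N.+1 => // n /= Nn.
have n0 : (0 < n%:R :> R)%R by rewrite ltr0n (leq_ltn_trans _ Nn).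
have up : (n%:R^-1 * a n <= sup S)%R.
  apply: ub_le_sup; first by exists C.
  by exists n.-1 => //; rewrite prednK// (leq_ltn_trans _ Nn).
have DN : (D < n%:R * (e / 2))%R.
  rewrite -ltr_pdivrMr// (lt_trans (archi_boundP _))//; first by rewrite divr_ge0// ltW.
  by rewrite ltr_nat.
rewrite ger0_norm ?subr_ge0// ltrBlDr -ltrBlDl.
rewrite mulrC ltr_pdivlMr//; have := aD n; rewrite /l; lra.
Qed.

Lemma cvg_invn (R : realType) : (n%:R^-1)%R @[n --> \oo] --> (0 : R)%R.
Proof.
rewrite -(cvg_shiftS (fun n => n%:R^-1 : R)%R); exact: cvg_harmonic.
Qed.

Lemma cvg_shift_ratio (R : realType) (s : nat) :
  ((n + s)%:R / n%:R)%R @[n --> \oo] --> (1 : R)%R.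
Proof.
have : (1 + s%:R * n%:R^-1)%R @[n --> \oo] --> (1 + s%:R * 0 : R)%R.
  by apply: cvgD; [exact: cvg_cst|apply: cvgMr; exact: cvg_invn].
rewrite mulr0 addr0; apply: cvg_trans; apply: near_eq_cvg.
exists 1%N => // n /= n1.
by rewrite natrD mulrDl mulfV// pnatr_eq0 -lt0n.
Qed.

Lemma rate_shift (R : realType) (b : nat -> R) (rho : R) (s : nat) :
  (n%:R^-1 * b n)%R @[n --> \oo] --> rho ->
  (n%:R^-1 * b (n + s)%N)%R @[n --> \oo] --> rho /\
  ((n + s)%:R^-1 * b n)%R @[n --> \oo] --> rho.
Proof.
move=> cvgb; split.
  have : ((n + s)%:R / n%:R * ((n + s)%:R^-1 * b (n + s)%N))%R @[n --> \oo] --> (1 * rho)%R.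
    apply: cvgM; first exact: cvg_shift_ratio.
    by rewrite (cvg_shiftn s (fun n => n%:R^-1 * b n)%R).
  rewrite mul1r; apply: cvg_trans; apply: near_eq_cvg.
  exists 1%N => // n /= n1; field.
  by rewrite -natrD !pnatr_eq0 -!lt0n n1 addn_gt0 n1.
have : (((n + s)%:R / n%:R)^-1 * (n%:R^-1 * b n))%R @[n --> \oo] --> (1^-1 * rho)%R.
  by apply: cvgM => //; apply: cvgV; [exact: oner_neq0|exact: cvg_shift_ratio].
rewrite invr1 mul1r; apply: cvg_trans; apply: near_eq_cvg.
exists 1%N => // n /= n1; field.
by rewrite -natrD !pnatr_eq0 -!lt0n n1 addn_gt0 n1.
Qed.

(** Shifting time by a bounded amount and multiplying by a factor [exp (o(n))]
    do not change an exponential rate. *)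
Lemma log_rate_sandwich (R : realType) (a hi : nat -> R) (rho lo : R)
    (s s' : nat) (x : nat -> \bar R) :
  (n%:R^-1 * a n)%R @[n --> \oo] --> rho ->
  (n%:R^-1 * hi n)%R @[n --> \oo] --> (0 : R)%R ->
  (\forall n \near \oo, (expR (a n + lo))%:E <= x (n + s)%N) ->
  (\forall n \near \oo, x n <= (expR (a (n + s')%N + hi n))%:E) ->
  (n%:R^-1)%:E * lne (x n) @[n --> \oo] --> rho%:E.
Proof.
move=> cvga cvghi lower upper.
rewrite -(cvg_shiftn s (fun n => (n%:R^-1)%:E * lne (x n))).
have [_ cvgl] := rate_shift _ _ _ s cvga.
have [cvgu _] := rate_shift _ _ _ s' cvga.
have lowcvg : ((n + s)%:R^-1 * (a n + lo))%R @[n --> \oo] --> rho.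
  rewrite -[rho]addr0.
  under eq_fun do rewrite mulrDr.
  apply: cvgD => //; rewrite -[X in _ --> X](mul0r lo); apply: cvgMl.
  by rewrite (cvg_shiftn s (fun n => n%:R^-1 : R)%R); exact: cvg_invn.
have upcvg : ((n + s)%:R^-1 * (a ((n + s) + s')%N + hi (n + s)%N))%R @[n --> \oo] --> rho.
  rewrite (cvg_shiftn s (fun n => n%:R^-1 * (a (n + s')%N + hi n))%R) -[rho]addr0.
  under eq_fun do rewrite mulrDr.
  exact: cvgD.
have upper' : \forall n \near \oo,
    x (n + s)%N <= (expR (a ((n + s) + s')%N + hi (n + s)%N))%:E.
  by case: upper => M _ HM; exists M => // n /= Mn; apply: HM => /=; rewrite (leq_trans Mn)// leq_addr.
have xE : \forall n \near \oo, exists y : R, [/\ (0 < y)%R, x (n + s)%N = y%:E,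
   (a n + lo <= ln y)%R & (ln y <= a ((n + s) + s')%N + hi (n + s)%N)%R].
  apply: filterS2 lower upper' => n lown upn.
  have xfin : x (n + s)%N \is a fin_num.
    rewrite fin_real// (le_lt_trans upn) ?ltry// andbT.
    by rewrite (lt_le_trans _ lown)// ltNyr.
  exists (fine (x (n + s)%N)); rewrite (fineK xfin).
  move: lown upn; rewrite -(fineK xfin) !lee_fin; set y := fine _ => lown upn.
  have y0 : (0 < y)%R by rewrite (lt_le_trans _ lown)// expR_gt0.
  by split=> //; rewrite -ler_expR lnK// posrE.
apply: cvg_EFin.
  by apply: filterS xE => n [y [y0 xy _ _]]; rewrite /= xy lne_EFin.
apply: squeeze_cvgr lowcvg upcvg.
apply: filterS xE => n [y [y0 xy l u]].
by rewrite /= xy lne_EFin//= !ler_wpM2l ?invr_ge0.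
Qed.

(** * Exponential decay of the return probabilities *)

Section decay_rate.
Context (R : realType) (K : nat -> nat -> \bar R) (e gamma : R).
Hypothesis K0 : forall k j, 0 <= K k j.
Notation pn := (iter_kernel R K).
Hypothesis pn_fin : forall n k j, pn n k j \is a fin_num.
Hypothesis e01 : (0 < e <= 1)%R.
Hypothesis down : forall l j, (j <= l)%N -> (e ^+ l.+2)%:E <= K l j.
Hypothesis up : forall k, exists2 i, (k < i)%N & 0 < K k i.
Hypothesis gamma01 : (0 <= gamma < 1)%R.
Hypothesis decay : forall n, pn n 1 1 <= (gamma ^+ n)%:E.

Let pn_ge0 n k j : 0 <= pn n k j.
Proof. exact: iter_kernel_ge0. Qed.

Let e0 : (0 < e)%R. Proof. by case/andP: e01. Qed.

Let down_gt0 l j : (j <= l)%N -> 0 < K l j.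
Proof. by move=> jl; apply: lt_le_trans (down _ _ jl); rewrite lte_fin exprn_gt0. Qed.

Let step_ge n k i j : pn n k i * K i j <= pn n.+1 k j.
Proof.
rewrite /=; apply: le_trans (nneseries_lim_ge i.+1 _); last first.
  by move=> l _ _; rewrite mule_ge0.
rewrite big_mkord big_ord_recr/= leeDr// sume_ge0// => l _.
by rewrite mule_ge0.
Qed.

Let one_step_ge k j : K k j <= pn 1 k j.
Proof. by have := step_ge 0 k k j; rewrite {1}/iter_kernel eqxx mul1e. Qed.

Let pos n : 0 < pn n 1 1.
Proof.
elim: n => [|n IH]; first by rewrite /= lte_fin.
by apply: lt_le_trans (step_ge n 1 1 1); rewrite mule_gt0// down_gt0.
Qed.

(** Climb beyond [j], then drop to [j] in one step. *)
Lemma reach_from1 j : exists b, 0 < pn b 1 j.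
Proof.
suff [b [l jl Pl]] : exists b, exists2 l, (j <= l)%N & 0 < pn b 1 l.
  exists b.+1; apply: lt_le_trans (step_ge b 1 l j).
  by rewrite mule_gt0// down_gt0.
elim: j => [|j [b [l jl Pl]]]; first by exists 0%N, 1%N => //=; rewrite lte_fin.
have [i li Ki] := up l; exists b.+1, i; first exact: leq_ltn_trans li.
by apply: lt_le_trans (step_ge b 1 l i); rewrite mule_gt0.
Qed.

Definition log_return n : R := ln (fine (pn n 1 1)).
Notation a := log_return.

Lemma return_expE n : pn n 1 1 = (expR (a n))%:E.
Proof.
rewrite /log_return lnK ?fineK// posrE fine_gt0// pos/=.
by rewrite -ge0_fin_numE.
Qed.

Lemma return_rate : exists2 rho : R, (rho < 0)%R &
  (n%:R^-1 * a n)%R @[n --> \oo] --> rho.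
Proof.
(* A positive bound is wanted for its logarithm; [gamma] may be [0]. *)
pose g := (Num.max gamma 2^-1)%R.
have g0 : (0 < g)%R by rewrite lt_max invr_gt0 ltr0n orbT.
have g1 : (g < 1)%R by rewrite gt_max; case/andP: gamma01 => _ ->/=; rewrite invf_lt1// ltr1n.
have a0 : a 0 = 0%R by rewrite /log_return /= ln1.
have asup n m : (a n + a m <= a (n + m)%N)%R.
  rewrite -ler_expR expRD -lee_fin EFinM -!return_expE.
  exact: iter_kernel_supermul.
have age n : (a n <= ln g * n%:R)%R.
  rewrite mulrC -ler_expR expRM_natl lnK ?posrE// -lee_fin -return_expE.
  apply: le_trans (decay n) _; rewrite lee_fin lerXn2r ?nnegrE ?(ltW g0)//.
    by case/andP: gamma01.
  by rewrite le_max lexx.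
have [rho rhog cvga] := superadditive_cvg R a (ln g) a0 asup age.
by exists rho => //; apply: le_lt_trans rhog _; rewrite ln_lt0// g0.
Qed.

(** Every transition probability between positive states is, up to constants,
    squeezed between two return probabilities of [1]. *)
Lemma transition_rate (rho : R) (k j : nat) :
  (n%:R^-1 * a n)%R @[n --> \oo] --> rho -> (0 < k)%N -> (0 < j)%N ->
  (n%:R^-1)%:E * lne (pn n k j) @[n --> \oo] --> rho%:E.
Proof.
move=> cvga k0 j0.
have [b Pb] := reach_from1 j; have [b' Pb'] := reach_from1 k.
have fp n l i : 0 < pn n l i -> pn n l i = (expR (ln (fine (pn n l i))))%:E.
  by move=> pp; rewrite lnK ?fineK// posrE fine_gt0// pp/= -ge0_fin_numE.
have Pk : 0 < pn 1 k 1 by apply: lt_le_trans (one_step_ge _ _); exact: down_gt0.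
have Pj : 0 < pn 1 j 1 by apply: lt_le_trans (one_step_ge _ _); exact: down_gt0.
pose lo := (ln (fine (pn 1 k 1)) + ln (fine (pn b 1 j)))%R.
pose hi := (- (ln (fine (pn b' 1 k)) + ln (fine (pn 1 j 1))))%R.
apply: (@log_rate_sandwich R a (fun=> hi) rho lo b.+1 b'.+1) => //.
- by rewrite -[X in _ --> X](mul0r hi); apply: cvgMl; exact: cvg_invn.
- apply: nearW => n; rewrite addnS -addSn -add1n.
  apply: le_trans (iter_kernel_supermul _ _ K0 pn_fin _ b k 1 j).
  apply: le_trans (lee_wpmul2r _ (iter_kernel_supermul _ _ K0 pn_fin 1 n k 1 1)) => //.
  rewrite (fp _ _ _ Pk) (fp _ _ _ Pb) return_expE -!EFinM lee_fin -!expRD ler_expR /lo.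
  lra.
- apply: nearW => n.
  have : pn b' 1 k * pn n k j * pn 1 j 1 <= pn (n + b'.+1)%N 1 1.
    rewrite (_ : (n + b'.+1)%N = ((b' + n) + 1)%N); last by rewrite addn1 addnS addnC.
    apply: le_trans (iter_kernel_supermul _ _ K0 pn_fin _ 1 1 j 1).
    by apply: lee_wpmul2r => //; exact: iter_kernel_supermul.
  rewrite (fp _ _ _ Pj) (fp _ _ _ Pb') return_expE -(fineK (pn_fin n k j)) -!EFinM !lee_fin.
  rewrite [in X in _ -> X]expRD /hi expRN expRD ler_pdivlMr ?mulr_gt0 ?expR_gt0//.
  by rewrite mulrCA mulrA.
Qed.

(** From a population of at most [k] the next generation has one individual
    with a probability at least [e ^ (k + 2)], a factor without exponential
    rate when [k = o(n)]. *)
Lemma small_population_rate (rho : R) (kn : nat -> R) (x : nat -> \bar R) :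
  (n%:R^-1 * a n)%R @[n --> \oo] --> rho ->
  (n%:R^-1 * kn n)%R @[n --> \oo] --> (0 : R)%R ->
  (\forall n \near \oo, pn n 1 1 <= x n) ->
  (forall n, x n = \sum_(0 <= i <oo)
     (if (0 < i)%N && (i%:R <= kn n)%R then pn n 1 i else 0)) ->
  (n%:R^-1)%:E * lne (x n) @[n --> \oo] --> rho%:E.
Proof.
move=> cvga cvgk lower xE.
pose hi n := ((kn n + 2) * - ln e)%R.
have lne0 : (ln e <= 0)%R by rewrite ln_le0//; case/andP: e01.
apply: (@log_rate_sandwich R a hi rho 0 0 1) => //.
- have : ((n%:R^-1 * kn n + n%:R^-1 * 2) * - ln e)%R @[n --> \oo] -->
      ((0 + 0 * 2) * - ln e)%R.
    by apply: cvgMl; apply: cvgD => //; apply: cvgMl; exact: cvg_invn.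
  rewrite mul0r addr0 mul0r; apply: cvg_trans; apply: near_eq_cvg.
  by apply: nearW => n; rewrite /hi /=; ring.
- by apply: filterS lower => n; rewrite addr0 addn0 return_expE.
apply: nearW => n.
have : (expR (- hi n))%:E * x n <= pn n.+1 1 1.
  rewrite xE -nneseriesZl; last by move=> i _; case: ifP.
  apply: lee_nneseries => [i _ _|i _]; first by case: ifP => _; rewrite mule_ge0// lee_fin expR_ge0.
  case: ifPn => [/andP[i0 ik]|_]; last by rewrite mule0 mule_ge0.
  rewrite muleC lee_wpmul2l//; apply: le_trans (down _ _ i0).
  rewrite lee_fin -[in leRHS](lnK (x := e)) ?posrE// -expRM_natl ler_expR /hi.
  rewrite mulrN opprK ler_wnM2r//.
  by rewrite -[i.+2]addn2 natrD lerD2r.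
move=> hx; rewrite [x n](_ : _ = (expR (hi n))%:E * ((expR (- hi n))%:E * x n)); last first.
  by rewrite muleA -EFinM -expRD subrr expR0 mul1e.
by rewrite addn1 addrC expRD EFinM -return_expE lee_wpmul2l ?lee_fin ?expR_ge0.
Qed.
End decay_rate.

Section annealed_return_decay.
Context (R : realType) (d : measure_display) (T : measurableType d)
  (P : probability T R) (X : T -> Delta R) (b : R).
Hypothesis mX : measurable_fun setT (X : T -> EnvSpace R).
Hypothesis b01 : (0 < b < 1)%R.
Hypothesis surv : {ae P, forall w, (X w).1 [set 0%N] < (1 - b)%:E}.
Hypothesis hm : {ae P, forall w, 0 < law_mean (X w).1 < +oo}.
Hypothesis hlog : P.-integrable setT (fun w => lne (law_mean (X w).1)).
Hypothesis hsuper : 0 < \int[P]_w lne (law_mean (X w).1).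
Hypothesis himm : 0 < P [set w | (mass R (X w).2 0%N < 1)%R].
Notation K := (annealed R d T P X).
Hypothesis pn_fin : forall n k j, iter_kernel R K n k j \is a fin_num.

Lemma annealed_up_all k : exists2 i, (k < i)%N & 0 < K k i.
Proof.
by case: k => [|k]; [exact: annealed_up0|exact: annealed_up].
Qed.

(** The Lyapunov function is a negative power of the population size, repaired
    near the origin. *)
Lemma annealed_return_decay : exists2 gamma : R, (0 <= gamma < 1)%R &
  forall n k, iter_kernel R K n k k <= (gamma ^+ n)%:E.
Proof.
have K0 k j : 0 <= K k j by exact: annealed_ge0.
have Kfin k j : K k j \is a fin_num.
  apply: integral01_fin_num => [|w]; last exact: quenched01.
  exact: (measurableT_comp (measurable_quenched R k j) mX).
have mS k J : measurable_fun setT (fun w => \sum_(j < J) quenched R (X w) k j)%R.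
  by apply: measurable_sum => j; exact: (measurableT_comp (measurable_quenched R k j) mX).
have S01 k J w : (0 <= \sum_(j < J) quenched R (X w) k j <= 1)%R.
  by rewrite sum_quenched_le1 andbT; apply: sumr_ge0 => j _; exact: quenched_ge0.
have [M EM] := trunc_log_mean_pos _ _ _ P X b mX b01 surv hm hlog hsuper.
have [alpha [g [K1 [a0 g01 drift]]]] := annealed_drift _ _ _ P X b mX b01 surv M EM.
have [|||||||k _|W [g' [W0 g'01 KW]]] := @lyapunov_repair R (fun k j => fine (K k j))
  (powN R alpha) K1.+1 g.
- by move=> k j; rewrite fine_ge0.
- move=> k J; have := annealed_sum R d T P X mX (fun=> 1%R) k J (fun=> ler01).
  under eq_bigr do rewrite mulr1.
  rewrite -lee_fin => ->; under eq_integral do under eq_bigr do rewrite mulr1.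
  have /andP[_] // := integral01 _ _ _ P (fun w => \sum_(j < J) quenched R (X w) k j)%R
    (mS k J) (S01 k J).
- by move=> k; exact: powN01 (ltW a0).
- by move=> k l; exact: powN_nonincreasing (ltW a0).
- exact: powN_decreasing.
- exact: g01.
- by move=> k J K1k; exact: drift (ltnW K1k).
- by have [i ki Ki] := annealed_up_all k; exists i => //; rewrite fine_gt0// Ki/= -ge0_fin_numE.
exists g' => // n k.
apply: (iter_kernel_decay _ _ _ _ W) => //; first by case/andP: g'01.
move=> l J; rewrite (eq_bigr (fun j : 'I_J => (fine (K l j) * W j)%:E)).
  by rewrite sumEFin lee_fin; exact: KW.
by move=> j _; rewrite EFinM fineK.
Qed.
End annealed_return_decay.

Theorem theorem3p1 (R : realType) (d : measure_display)
    (T : measurableType d) (P : probability T R)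
    (Q : T -> Delta R) (Qn : nat -> T -> Delta R)
    (N : nat -> nat -> T -> nat) (Y : nat -> T -> nat)
    (hZ : branching_data P Q Qn N Y)
    (hm : {ae P, forall w, 0 < law_mean (Qn 0%N w).1 < +oo})
    (hlog : P.-integrable setT (fun w => lne (law_mean (Qn 0%N w).1)))
    (hsuper : 0 < \int[P]_w lne (law_mean (Qn 0%N w).1))
    (himm : 0 < P [set w | (Q w).2 [set 0%N] < 1])
    (hA : 0 < P [set w | [/\ 0 < (Q w).2 [set 0%N],
                             0 < (Q w).1 [set 0%N]
                           & 0 < (Q w).1 [set 1%N]]])
    (hB : exists2 delta : R, (0 < delta < 1)%R &
            {ae P, forall w, (Q w).1 [set 0%N] < delta%:E}) :
  exists rho : R, [/\ (rho < 0)%R,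
    forall k j : nat, (1 <= k)%N -> (1 <= j)%N ->
      (n%:R^-1)%:E * lne (P [set w | bpire N Y k n w = j]) @[n --> \oo]
        --> rho%:E
  & forall kn : nat -> R,
      (\forall n \near \oo, (1 <= kn n)%R) ->
      (kn n / n%:R)%R @[n --> \oo] --> (0 : R)%R ->
      (n%:R^-1)%:E *
        lne (P [set w | (1 <= bpire N Y 1 n w)%N
                        /\ ((bpire N Y 1 n w)%:R <= kn n)%R]) @[n --> \oo]
        --> rho%:E].
Proof.
have hZ' := branching_data_env0 _ _ _ _ _ _ _ _ hZ.
have [mQ [mQn eqQ _] _ _ _] := hZ.
have mX := measurable_env R d T (Qn 0%N) (mQn 0%N).
have law n k j := bpire_law R d T P (Qn 0%N) Qn N Y hZ' k n j.
set X := Qn 0%N in hZ' mX law hm hlog hsuper.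
pose K := annealed R d T P X.
have K0 k j : 0 <= K k j by exact: annealed_ge0.
have pn_fin n k j : iter_kernel R K n k j \is a fin_num.
  rewrite -law fin_num_measure//.
  exact: (measurable_bpire_set R d T P X Qn N Y hZ' k n [set j]).
have m1 (j : nat) : measurable_fun [set: EnvSpace R] (fun q : EnvSpace R => mass R q.1 j).
  exact: measurable_offspring.
have m2 (j : nat) : measurable_fun [set: EnvSpace R] (fun q : EnvSpace R => mass R q.2 j).
  exact: measurable_immigration.
have massE (p : probability nat R) j : p [set j] = (mass R p j)%:E.
  by rewrite fineK// fin_num_measure.
have himm' : 0 < P [set w | (mass R (X w).2 0%N < 1)%R].
  rewrite (_ : [set _ | _] = X @^-1` ((fun q : EnvSpace R => mass R q.2 0%N)
      @^-1` `]-oo, 1%R[%classic)); last first.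
    by apply/seteqP; split => w /=; rewrite in_itv.
  rewrite eqQ; last by rewrite -[X in Delta_borel X]setTI; exact: m2.
  rewrite (_ : _ @^-1` _ = [set w | (Q w).2 [set 0%N] < 1])//.
  by apply/seteqP; split => w /=; rewrite in_itv massE lte_fin.
have hA' : 0 < P [set w | (0 < Num.min (mass R (X w).2 0%N)
                   (Num.min (mass R (X w).1 0%N) (mass R (X w).1 1%N)))%R].
  pose g (q : EnvSpace R) := Num.min (mass R q.2 0%N)
                   (Num.min (mass R q.1 0%N) (mass R q.1 1%N)).
  have mg : measurable_fun setT g.
    by apply: measurable_minr => //; apply: measurable_minr.
  rewrite (_ : [set _ | _] = X @^-1` (g @^-1` `]0%R, +oo[%classic)); last first.
    by apply/seteqP; split => w /=; rewrite in_itv andbT.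
  rewrite eqQ; last by rewrite -[X in Delta_borel X]setTI; exact: mg.
  rewrite (_ : _ @^-1` _ = [set w | [/\ 0 < (Q w).2 [set 0%N],
           0 < (Q w).1 [set 0%N] & 0 < (Q w).1 [set 1%N]]])//.
  apply/seteqP; split => w /=; rewrite in_itv andbT !massE !lte_fin /g/= !lt_min.
    by move=> /and3P.
  by move=> ?; apply/and3P.
have [delta /andP[d0 d1] hdelta] := hB.
have b01 : (0 < 1 - delta < 1)%R by apply/andP; split; lra.
have surv : {ae P, forall w, (X w).1 [set 0%N] < (1 - (1 - delta))%:E}.
  pose B := (fun q : EnvSpace R => mass R q.1 0%N) @^-1` `[delta, +oo[%classic.
  have mB : Delta_borel B by rewrite -[X in Delta_borel X]setTI; exact: m1.
  have QB : P (Q @^-1` B) = 0.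
    apply/negligibleP; first exact: mQ.
    apply: negligibleS hdelta => w /=; rewrite /B /= in_itv/= andbT => dw.
    by rewrite massE lte_fin ltNge dw.
  have : P.-negligible (X @^-1` B).
    by apply/negligibleP; [exact: mQn|rewrite -QB; exact: eqQ].
  apply: negligibleS => w /=; rewrite /B /= in_itv/= andbT massE lte_fin => /negP.
  by rewrite -leNgt; apply: contraTT; rewrite -!ltNge; lra.
have [gamma gamma01 decay] := annealed_return_decay R d T P X _ mX b01 surv hm hlog
  hsuper himm' pn_fin.
have [e e01 down] := annealed_down R d T P X mX hA'.
have up := annealed_up_all R d T P X mX hlog hsuper himm'.
have [rho rho0 cvga] := return_rate R K e gamma K0 pn_fin e01 down gamma01 (fun n => decay n 1%N).
exists rho; split=> //.
  move=> k j k1 j1; under eq_fun do rewrite law.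
  exact: (transition_rate R K e K0 pn_fin e01 down up).
move=> kn kn1 kn0.
have mev n k1 : measurable [set w | (1 <= bpire N Y 1 n w)%N /\ ((bpire N Y 1 n w)%:R <= k1 :> R)%R].
  exact: (measurable_bpire_set R d T P X Qn N Y hZ' 1 n [set i | (1 <= i)%N /\ (i%:R <= k1 :> R)%R]).
apply: (small_population_rate R K e K0 pn_fin e01 down rho kn) => //.
- by under eq_fun do rewrite mulrC.
- apply: filterS kn1 => n kn1; rewrite -law; apply: le_measure; rewrite ?inE//.
    exact: (measurable_bpire_set R d T P X Qn N Y hZ' 1 n [set 1%N]).
  by move=> w /= ->.
move=> n; rewrite (@measure_fibers _ _ _ P (bpire N Y 1 n))//; last first.
  exact: measurable_bpire hZ' _ _.
apply: eq_eseriesr => i _; case: ifPn => [/andP[i0 ik]|nik].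
  rewrite -law; congr (P _); apply/seteqP; split => [w [_ //]|w /= Zi].
  by split => //=; rewrite Zi.
rewrite (_ : _ `&` _ = set0) ?measure0//; apply/seteqP; split => // w [/= [h1 h2] Zi].
by move/negP: nik; apply; rewrite -Zi h1 h2.
Qed.
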